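(* Let $m,n\ge1$ be integers, $k=\gcd(m,n)$, $d'=(m+n)/k$, and $P_{m,n}(z)=\frac{(m+n)^{m+n}}{m^m n^n}z^m(1-z)^n$, regarded as a covering $\mathbb{P}^1_{\mathbb{C}}\to\mathbb{P}^1_{\mathbb{C}}$ of degree $m+n$ branched only over $\{0,1,\infty\}$. Then its monodromy group satisfies $$\mathrm{Mon}(P_{m,n})\cong \mathfrak{S}_{d'}\wr\mathbb{Z}/k,$$ acting imprimitively with exactly $k$ blocks of size $d'$. In particular, $\mathrm{Mon}(P_{m,n})=\mathfrak{S}_{m+n}$ if and only if $\gcd(m,n)=1$, and in general $|\mathrm{Mon}(P_{m,n})|=(d'!)^k\,k$.
   Context: $\mathfrak{S}_r$ is the symmetric group on $r$ letters. For a covering $t\colon X\to\mathbb{P}^1$ of degree $d$ unramified outside $\{0,1,\infty\}$, $\mathrm{Mon}(t)\le\mathfrak{S}_d$ is the image of the monodromy representation $\pi_1(\mathbb{P}^1(\mathbb{C})\setminus\{0,1,\infty\},* )\to\mathfrak{S}_d$ on the fibre $t^{-1}( * )$, defined up to conjugacy. For $C\le\mathfrak{S}_b$, the wreath product $\mathfrak{S}_a\wr C$ is $(\mathfrak{S}_a)^b\rtimes C$, with $C$ permuting the $b$ coordinates, in its imprimitive action on the $ab$ letters $\{1,\dots,a\}\times\{1,\dots,b\}$: the base group acts within the $b$ blocks $\{1,\dots,a\}\times\{j\}$ and $C$ permutes the blocks. $\mathfrak{S}_a\wr\mathbb{Z}/b$ means $\mathfrak{S}_a\wr C$ with $C\le\mathfrak{S}_b$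 generated by a $b$-cycle. When $k=1$ there is just one block, the whole set. *)

(* Defs.v *)
From HB Require Import structures.
From mathcomp Require Import all_boot all_order all_algebra all_fingroup.
From mathcomp Require Import complex.
From mathcomp Require Import all_classical all_reals all_analysis.

Set Implicit Arguments.
Unset Strict Implicit.
Unset Printing Implicit Defensive.

Import Order.TTheory GRing.Theory Num.Theory.
Import numFieldNormedType.Exports.

Local Open Scope classical_set_scope.
Local Open Scope ring_scope.

Section Monodromy.
Variables (R : realType) (X Y : topologicalType).
Variables (t : X -> Y) (B : set Y).

(* Paths are functions on R of which only the restriction to [0, 1] matters. *)
Definition loop_at (b : Y) (g : R -> Y) : Prop :=
  [/\ {within `[0, 1], continuous g},
      (forall u : R, u \in `[0, 1] -> ~ B (g u)),
      g 0 = b & g 1 = b].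

Definition lift_of (g : R -> Y) (h : R -> X) : Prop :=
  {within `[0, 1], continuous h} /\
  (forall u : R, u \in `[0, 1] -> t (h u) = g u).

Definition fibre_numbering (b : Y) (d : nat) (e : 'I_d -> X) : Prop :=
  set_bij [set: 'I_d] (t @^-1` [set b]) e.

(* The permutations through which the loops at b avoiding B act, by path      *)
(* lifting, on the fibre numbered by e.  The action of a class in             *)
(* pi_1(Y \ B, b) is that of any loop representing it, so this set is the     *)
(* image of the monodromy representation.  Changing e conjugates it.          *)
Definition Mon (b : Y) (d : nat) (e : 'I_d -> X) : {set 'S_d} :=
  [set s : 'S_d | `[< exists2 g, loop_at b g &
     forall i : 'I_d, exists2 h, lift_of g h & h 0 = e i /\ h 1 = e (s i) >]]%SET.

End Monodromy.

Arguments Mon R {X Y} t B b {d} e.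

(* Typed as a numClosedFieldType so that it carries the topology of its norm. *)
Definition CC (R : realType) : numClosedFieldType := R[i]%C.

(* The Riemann sphere; None is the point at infinity. *)
Definition P1 (R : realType) : Type :=
  one_point_compactification (CC R).

(* The self-map of the sphere defined by a nonconstant polynomial. *)
Definition poly_P1 (R : realType) (p : {poly CC R}) (z : P1 R) : P1 R :=
  if z is Some x then Some p.[x] else None.

Definition zero_one_infty (R : realType) : set (P1 R) :=
  [set Some 0; Some 1; None].

Definition Pmn (R : realType) (m n : nat) : {poly CC R} :=
  ((m + n)%:R ^+ (m + n) / (m%:R ^+ m * n%:R ^+ n)) *: ('X^m * (1 - 'X) ^+ n).

Section Wreath.
Variables a b : nat.

(* S_a wr C in its imprimitive action: the letter (i, j) lies in block j. *)
Definition wreath (C : {set 'S_b}) : {set {perm 'I_a * 'I_b}} :=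
  [set s : {perm 'I_a * 'I_b} | [exists c in C,
     [exists f : {ffun 'I_b -> 'S_a},
       [forall x : 'I_a * 'I_b, s x == (f x.2 x.1, c x.2)]]]]%SET.

(* The b-cycle j |-> j + 1 mod b. *)
Definition rotation : 'S_b := perm (@ordS_inj b).

(* S_a wr Z/b *)
Definition wreath_cyclic : {set {perm 'I_a * 'I_b}} := wreath <[rotation]>%g.

End Wreath.

(* Isomorphism of permutation groups: a bijection of the letters carries one  *)
(* group onto the other.                                                      *)
Definition perm_isomorphic (S T : finType)
    (G : {set {perm S}}) (H : {set {perm T}}) : Prop :=
  exists2 f : S -> T, bijective f &
    forall (s : {perm S}) (u : {perm T}),
      (forall x, f (s x) = u (f x)) -> (s \in G) = (u \in H).

(* Unlike imprimitivity_system, the trivial partitions are allowed. *)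
Definition block_system (T : finType) (G : {set {perm T}})
    (Q : {set {set T}}) : bool :=
  finset.partition Q [set: T]%SET && [acts G, on Q | 'P^*].

(* Main.v *)
Require Import Defs.
From HB Require Import structures.
From mathcomp Require Import all_boot all_order all_algebra all_fingroup cyclic.
From mathcomp Require Import complex.
From mathcomp Require Import all_classical all_reals all_analysis.
From mathcomp Require Import ring lra.

Set Implicit Arguments.
Unset Strict Implicit.
Unset Printing Implicit Defensive.

Import Order.TTheory GRing.Theory Num.Theory.
Import numFieldNormedType.Exports.

(* Write p = P_{m,n}, k = gcd(m, n), z0 = m / (m + n) for the critical point   *)
(* over 1, and f = z^(m/k) (1 - z)^(n/k), so that f^k is a multiple of p.      *)
(* Along lifts of a loop f is multiplied by one root of unity, the same for    *)
(* all points of the fibre; so the monodromy group lies in the wreath product  *)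
(* that permutes the k values of f on the fibre cyclically.  Conversely, over  *)
(* a real base point close to 1, the circle around 1 exchanges the two real    *)
(* points x < z0 < y of the fibre and fixes the others.  The circle around 0   *)
(* cannot move a point across the line Re z = z0, where |p| >= 1; following    *)
(* the argument of z^m (1 - z)^n on either side, it acts as an m-cycle on the  *)
(* left and an n-cycle on the right.  Conjugating the transposition by its     *)
(* powers yields every transposition of two points with the same value of f    *)
(* (Chinese remainders), hence the whole wreath product.  A path in the base   *)
(* carries the result to any other base point.                                 *)

(** Everything rests on an exact description of the monodromy group, [monodromyE]: with f =
    [root_Pmn], a permutation s of the fibre e belongs to it exactly when f(e (s i)) / f(e i) does
    not depend on i. On the fibre f^k is constant and f has degree d' = (m+n)/k, so the m+n points
    are spread evenly: each of the k possible values of f is taken d' times ([coloring_of_fibre]).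
    The permutations described then rotate the k level sets of f and are arbitrary inside them. This
    is the wreath product with the level sets as blocks ([colored_wreath], [colored_blocks],
    [colored_full]); its order is [card_wreath].

    That monodromy has this form is rigidity: along two lifts of one path the quotient of the values
    of f has k-th power 1, hence is constant ([moves_power_ratio]). The converse needs two loops,
    lifted by [path_lifting]: [rotation_around_zero] and [transposition_around_one]. In
    [good_base_exists] the powers of the rotation r carry the two exchanged points to L j on the
    left and K j on the right, with periods m and n, and conjugation by them gives the
    transpositions of L j and K j. By [common_residue] these include every pair L i, K j with i = j
    mod k, that is, with the same value of f. Conjugating once more gives pairs on the same side,
    and [perm_of_tperms] gives all permutations that preserve f; powers of r supply the rotations of
    the level sets. [moves_to_real] transports the result to any base point.

    The analysis is elementary. Lifts come from a bound on the distance to the nearest root of a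
    polynomial ([nearby_root]), and winding is measured by dividing out an explicit turning factor
    and using that a continuous function with a constant power is constant ([power_constant]).
    [Mon_monodromy] passes between the plane and the sphere. *)

Section ComplexPlane.
Variable R : realType.
Local Open Scope ring_scope.
Implicit Types (x y : R) (z w : CC R).

Definition re z : R := complex.Re z.
Definition im z : R := complex.Im z.
(** The norm of [CC R] takes values in [CC R]; its real part makes it a real number, so that real
    estimates apply. *)
Definition modulus z : R := complex.Re `|z|.
Definition ofR x : CC R := real_complex R x.
Definition cplx x y : CC R := Complex x y.

HB.instance Definition _ := GRing.RMorphism.copy ofR (real_complex R).

Lemma complexP z w : re z = re w -> im z = im w -> z = w.
Proof. by rewrite /re /im; case: z w => [a b] [c d] /= -> ->. Qed.

Lemma cplxE x y : cplx x y = ofR x + ofR y * cplx 0 1.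
Proof.
rewrite /cplx /ofR /= /real_complex_def; apply: complexP; rewrite /re /im /=.
  by rewrite mulr0 mul0r subr0 addr0.
by rewrite mulr1 mul0r addr0 add0r.
Qed.

Lemma re_ofR x : re (ofR x) = x. Proof. by []. Qed.
Lemma im_ofR x : im (ofR x) = 0. Proof. by []. Qed.
Lemma re_cplx x y : re (cplx x y) = x. Proof. by []. Qed.
Lemma im_cplx x y : im (cplx x y) = y. Proof. by []. Qed.
Lemma reD z w : re (z + w) = re z + re w. Proof. by case: z w => [? ?] []. Qed.
Lemma imD z w : im (z + w) = im z + im w. Proof. by case: z w => [? ?] []. Qed.
Lemma reN z : re (- z) = - re z. Proof. by case: z. Qed.
Lemma imN z : im (- z) = - im z. Proof. by case: z. Qed.
Lemma reB z w : re (z - w) = re z - re w. Proof. by rewrite reD reN. Qed.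
Lemma imB z w : im (z - w) = im z - im w. Proof. by rewrite imD imN. Qed.
Lemma reM z w : re (z * w) = re z * re w - im z * im w.
Proof. by case: z w => [? ?] []. Qed.
Lemma imM z w : im (z * w) = re z * im w + im z * re w.
Proof. by case: z w => [? ?] []. Qed.
Lemma re1 : re 1 = 1. Proof. by []. Qed.
Lemma im1 : im 1 = 0. Proof. by []. Qed.
Lemma im0 : im 0 = 0. Proof. by []. Qed.

Lemma ofR_inj : injective ofR. Proof. by move=> x y []. Qed.

Lemma modulusE z : ofR (modulus z) = `|z|.
Proof. by rewrite /modulus /ofR; case: z. Qed.

Lemma modulus_sqr z : modulus z ^+ 2 = re z ^+ 2 + im z ^+ 2.
Proof.
rewrite /modulus /re /im; case: z => a b /=.
by rewrite sqr_sqrtr // addr_ge0 ?sqr_ge0.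
Qed.

Lemma ler_ofR x y : (ofR x <= ofR y) = (x <= y).
Proof. exact: lecR. Qed.

Lemma ltr_ofR x y : (ofR x < ofR y) = (x < y).
Proof. exact: ltcR. Qed.

Lemma modulus_ge0 z : 0 <= modulus z.
Proof. by rewrite -ler_ofR modulusE rmorph0. Qed.

Lemma modulus_eq0 z : (modulus z == 0) = (z == 0).
Proof.
by rewrite -(inj_eq ofR_inj) modulusE rmorph0 normr_eq0.
Qed.

Lemma modulus0 : modulus 0 = 0.
Proof. by apply/eqP; rewrite modulus_eq0. Qed.

Lemma modulus_gt0 z : (0 < modulus z) = (z != 0).
Proof. by rewrite lt_neqAle modulus_ge0 andbT eq_sym modulus_eq0. Qed.

Lemma modulusM z w : modulus (z * w) = modulus z * modulus w.
Proof. by apply: ofR_inj; rewrite rmorphM /= !modulusE normrM. Qed.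

Lemma modulusX z n : modulus (z ^+ n) = modulus z ^+ n.
Proof. by apply: ofR_inj; rewrite rmorphXn /= !modulusE normrX. Qed.

Lemma modulusD z w : modulus (z + w) <= modulus z + modulus w.
Proof. by rewrite -ler_ofR rmorphD /= !modulusE ler_normD. Qed.

Lemma modulus_distC z w : modulus (z - w) = modulus (w - z).
Proof. by apply: ofR_inj; rewrite !modulusE distrC. Qed.

Lemma modulus_tri v z w : modulus (z - w) <= modulus (z - v) + modulus (v - w).
Proof. by rewrite -[z - w](subrKA v) modulusD. Qed.

Lemma modulus_prod (I : Type) (r : seq I) (F : I -> CC R) :
  modulus (\prod_(i <- r) F i) = \prod_(i <- r) modulus (F i).
Proof.
apply: ofR_inj; rewrite rmorph_prod /= modulusE normr_prod.
by apply: eq_bigr => i _; rewrite modulusE.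
Qed.

Lemma modulus_ofR x : modulus (ofR x) = `|x|.
Proof.
apply/eqP; rewrite -(@eqrXn2 _ 2) ?modulus_ge0 // modulus_sqr re_ofR im_ofR.
by rewrite expr0n addr0 real_normK ?num_real.
Qed.

Lemma re_le_modulus z : `|re z| <= modulus z.
Proof.
rewrite -ler_sqr ?nnegrE ?modulus_ge0 // modulus_sqr real_normK ?num_real //.
by rewrite lerDl sqr_ge0.
Qed.

Lemma im_le_modulus z : `|im z| <= modulus z.
Proof.
rewrite -ler_sqr ?nnegrE ?modulus_ge0 // modulus_sqr real_normK ?num_real //.
by rewrite lerDr sqr_ge0.
Qed.

Lemma modulus_cplx_le x y : modulus (cplx x y) <= `|x| + `|y|.
Proof.
rewrite cplxE; apply: (le_trans (modulusD _ _)).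
rewrite modulusM !modulus_ofR lerD2l.
suff -> : modulus (cplx 0 1) = 1 by rewrite mulr1.
apply/eqP; rewrite -(@eqrXn2 _ 2) ?modulus_ge0 // modulus_sqr re_cplx im_cplx.
by rewrite expr0n expr1n add0r.
Qed.

(** The radii in the norm topology are positive elements of [CC R]; being positive they are real, so
    real radii suffice. *)
Lemma cvg_modulusP (T : Type) (F : set_system T) (FF : Filter F)
    (f : T -> CC R) z :
  (f @ F --> z)%classic <->
  forall e : R, 0 < e -> \forall t \near F, modulus (f t - z) < e.
Proof.
rewrite cvgrPdist_lt; split=> H e e0.
  have := H (ofR e); rewrite -[0](rmorph0 ofR) ltr_ofR => /(_ e0).
  by apply: filterS => t; rewrite -modulusE ltr_ofR modulus_distC.
have er : e = ofR (re e).
  apply: complexP => //; rewrite im_ofR.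
  by move: e0; rewrite ltcE => /andP[/eqP /=].
move: (e0); rewrite er -[0](rmorph0 ofR) ltr_ofR => /H.
by apply: filterS => t; rewrite -modulusE ltr_ofR modulus_distC.
Qed.

Lemma continuous_lipschitz (T : topologicalType) (g : T -> R) (f : T -> CC R) :
  continuous f -> (forall s t, `|g s - g t| <= modulus (f s - f t)) ->
  continuous g.
Proof.
move=> cf H t; apply/cvgrPdist_lt => e e0.
have /cvg_modulusP /(_ e e0) := cf t.
by apply: filterS => s; apply: le_lt_trans; rewrite distrC.
Qed.

Lemma continuous_re (T : topologicalType) (f : T -> CC R) :
  continuous f -> continuous (fun t => re (f t)).
Proof.
move=> cf; apply: (continuous_lipschitz cf) => s t.
by rewrite -reB re_le_modulus.
Qed.

Lemma continuous_im (T : topologicalType) (f : T -> CC R) :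
  continuous f -> continuous (fun t => im (f t)).
Proof.
move=> cf; apply: (continuous_lipschitz cf) => s t.
by rewrite -imB im_le_modulus.
Qed.

Lemma continuous_modulus (T : topologicalType) (f : T -> CC R) :
  continuous f -> continuous (fun t => modulus (f t)).
Proof.
move=> cf; apply: (continuous_lipschitz cf) => s t.
rewrite ler_norml; apply/andP; split.
  rewrite lerBrDr addrC lerBlDl modulus_distC.
  by have := modulusD (f t - f s) (f s); rewrite subrK addrC.
by rewrite lerBlDr; have := modulusD (f s - f t) (f t); rewrite subrK.
Qed.

Lemma continuous_cplx (T : topologicalType) (f g : T -> R) :
  continuous f -> continuous g -> continuous (fun t => cplx (f t) (g t)).
Proof.
move=> cf cg t; apply/cvg_modulusP => e e0.
have e2 : 0 < e / 2 by rewrite divr_gt0.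
have /cvgrPdist_lt/(_ _ e2) Hf := cf t.
have /cvgrPdist_lt/(_ _ e2) Hg := cg t.
near=> s; have -> : cplx (f s) (g s) - cplx (f t) (g t) =
    cplx (f s - f t) (g s - g t) by [].
apply: (le_lt_trans (modulus_cplx_le _ _)).
rewrite [e]splitr ltrD // distrC; first by near: s; exact: Hf.
by near: s; exact: Hg.
Unshelve. all: by end_near. Qed.

Lemma continuous_ofR (T : topologicalType) (f : T -> R) :
  continuous f -> continuous (fun t => ofR (f t)).
Proof.
move=> cf; apply: (continuous_cplx cf (g := fun=> 0)) => t.
exact: cvg_cst.
Qed.

(** This turns the Lipschitz bound for local inverses of a polynomial into continuity along a
    path. *)
Lemma continuous_lift (T : topologicalType) (s : CC R -> CC R)
    (U : set (CC R)) (L : R) (g : T -> CC R) :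
    (forall z w, U z -> U w -> modulus (s z - s w) <= L * modulus (z - w)) ->
    (forall t, U (g t)) -> continuous g ->
  continuous (fun t => s (g t)).
Proof.
move=> sL gU cg t; apply/cvg_modulusP => e e0.
have L0 : 0 < `|L| + 1 by rewrite ltr_pwDr.
have /cvg_modulusP /(_ (e / (`|L| + 1)) (divr_gt0 e0 L0)) := cg t.
apply: filterS => u; rewrite ltr_pdivlMr // => h.
apply: (le_lt_trans (sL _ _ (gU u) (gU t))); apply: le_lt_trans h.
rewrite mulrC; apply: ler_wpM2l; first exact: modulus_ge0.
by rewrite (le_trans (ler_norm L)) // lerDl.
Qed.

Lemma continuous_add (T : topologicalType) (f g : T -> CC R) :
  continuous f -> continuous g -> continuous (fun t => f t + g t).
Proof. by move=> cf cg t; exact: (cvgD (cf t) (cg t)). Qed.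

Lemma continuous_sub (T : topologicalType) (f g : T -> CC R) :
  continuous f -> continuous g -> continuous (fun t => f t - g t).
Proof. by move=> cf cg t; exact: (cvgB (cf t) (cg t)). Qed.

Lemma continuous_mul (T : topologicalType) (f g : T -> CC R) :
  continuous f -> continuous g -> continuous (fun t => f t * g t).
Proof. by move=> cf cg t; exact: (cvgM (cf t) (cg t)). Qed.

Lemma continuous_div (T : topologicalType) (f g : T -> CC R) :
  continuous f -> continuous g -> (forall t, g t != 0) ->
  continuous (fun t => f t / g t).
Proof.
by move=> cf cg g0 t; exact: (cvgM (cf t) (cvgV (g0 t) (cg t))).
Qed.

Lemma continuous_const (T : topologicalType) z : continuous (fun _ : T => z).
Proof. by move=> t; exact: cvg_cst. Qed.

Lemma continuous_poly (T : topologicalType) (p : {poly CC R}) (f : T -> CC R) :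
  continuous f -> continuous (fun t => p.[f t]).
Proof.
move=> cf; elim/poly_ind: p => [|p c IH].
  by under eq_fun do rewrite horner0; exact: continuous_const.
under eq_fun do rewrite hornerMXaddC.
by apply: continuous_add; [exact: continuous_mul | exact: continuous_const].
Qed.

(** By the intermediate value theorem, c is a barrier. This is what confines lifts to half-planes
    and discs. *)
Lemma stays_below (G : R -> R) (c : R) (s : R) :
  continuous G -> (forall t, G t != c) -> G s < c -> forall t, G t < c.
Proof.
move=> cG nc Gs t; rewrite ltNge; apply/negP => Gt.
have [u _ Gu] : exists2 u, u \in `[Num.min s t, Num.max s t] & G u = c.
  apply: IVT; first by rewrite ge_min le_max !lexx.
    exact: continuous_subspaceT.
  case: (leP s t) => st; rewrite /= ge_min le_max (ltW Gs) Gt ?orbT //.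
by move: (nc u); rewrite Gu eqxx.
Qed.

Lemma isolated (s : seq (CC R)) z :
  exists2 e : R, 0 < e & forall w, w \in s -> w != z -> e <= modulus (w - z).
Proof.
elim: s => [|v s [e e0 IH]]; first by exists 1.
have [vz|vz] := eqVneq v z.
  exists e => // w; rewrite inE => /orP[/eqP->|]; last exact: IH.
  by rewrite vz eqxx.
exists (Num.min e (modulus (v - z))).
  by rewrite lt_min e0 modulus_gt0 subr_eq0.
move=> w; rewrite inE => /orP[/eqP-> _|ws wz]; first by rewrite ge_min lexx orbT.
by rewrite ge_min IH.
Qed.

(** The roots are finite in number, so the distance from F u to F s is either 0 or at least e; the
    barrier is e / 2. *)
Lemma root_constant (q : {poly CC R}) (F : R -> CC R) :
  q != 0 -> continuous F -> (forall t, root q (F t)) -> forall s t, F t = F s.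
Proof.
move=> q0 cF qF s t.
have [r qE] := closed_field_poly_normal q.
have Fr u : F u \in r.
  by have := qF u; rewrite qE rootZ ?lead_coef_eq0 // root_prod_XsubC.
have [e e0 He] := isolated r (F s).
apply/eqP; apply: contraT => nF.
have e2 : e / 2 < e by rewrite ltr_pdivrMr // ltr_pMr // ltr1n.
suff h : modulus (F t - F s) < e / 2.
  by have := lt_trans h e2; rewrite ltNge He.
apply: (@stays_below (fun u => modulus (F u - F s)) (e / 2) s) => [|u|].
- apply: continuous_modulus.
  by apply: continuous_sub; [exact: cF | exact: continuous_const].
- have [->|nFu] := eqVneq (F u) (F s).
    by rewrite subrr lt_eqF // modulus0 // divr_gt0.
  by rewrite gt_eqF // (lt_le_trans e2) // He.
- by rewrite subrr modulus0 // divr_gt0.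
Qed.

Lemma power_constant k (c : CC R) (F : R -> CC R) :
  (0 < k)%N -> continuous F -> (forall t, F t ^+ k = c) ->
  forall s t, F t = F s.
Proof.
move=> k0 cF Fc; apply: (@root_constant ('X^k - c%:P)) => //.
  exact/monic_neq0/monicXnsubC.
by move=> t; rewrite /root !hornerE Fc subrr.
Qed.

End ComplexPlane.

(** * Roots of unity and the winding of continuous roots *)

Section UnitCircle.
Variable R : realType.
Local Open Scope ring_scope.
Implicit Types (x y : R) (z w : CC R).

Definition cis x : CC R := cplx (cos x) (sin x).

Lemma cis0 : cis 0 = 1.
Proof. by apply: complexP; rewrite ?re_cplx ?im_cplx ?cos0 ?sin0. Qed.

Lemma cisD x y : cis (x + y) = cis x * cis y.
Proof.
apply: complexP; rewrite ?reM ?imM !re_cplx !im_cplx ?cosD ?sinD //.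
by rewrite addrC.
Qed.

Lemma cisMn n x : cis (x *+ n) = cis x ^+ n.
Proof.
by elim: n => [|n IH]; rewrite ?mulr0n ?cis0 // mulrS exprS cisD IH.
Qed.

Lemma modulus_cis x : modulus (cis x) = 1.
Proof.
apply/eqP; rewrite -(@eqrXn2 _ 2) ?modulus_ge0 // modulus_sqr re_cplx im_cplx.
by rewrite cos2Dsin2 expr1n.
Qed.

Lemma cis_neq0 x : cis x != 0.
Proof. by rewrite -modulus_eq0 modulus_cis oner_eq0. Qed.

Lemma cis2pi : cis (pi *+ 2) = 1.
Proof. by apply: complexP; rewrite ?re_cplx ?im_cplx ?cos2pi ?sin2pi. Qed.

Lemma cis_neq1 x : 0 < x < pi *+ 2 -> cis x != 1.
Proof.
move=> /andP[x0 x2]; apply/eqP => /(congr1 (@re R)).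
rewrite re_cplx re1 [x](_ : _ = (x / 2) *+ 2); last by rewrite -mulr_natr divfK.
rewrite cos_mulr2n cos2sin2 => h.
have : 0 < sin (x / 2).
  by apply: sin_gt0_pi; rewrite divr_gt0 //= ltr_pdivrMr // mulr_natr.
by move/(exprn_gt0 2); nra.
Qed.

Lemma continuous_cis (T : topologicalType) (f : T -> R) :
  continuous f -> continuous (fun t => cis (f t)).
Proof.
move=> cf; apply: continuous_cplx => t.
  by apply: (continuous_comp (cf t)); exact: continuous_cos.
by apply: (continuous_comp (cf t)); exact: continuous_sin.
Qed.

Definition zeta n : CC R := cis (pi *+ 2 / n%:R).

(** A smaller order k would put the angle 2 pi k / n strictly between 0 and 2 pi, where [cis] is not
    1. *)
Lemma zeta_prim n : (0 < n)%N -> n.-primitive_root (zeta n).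
Proof.
move=> n0; have nR : n%:R != 0 :> R by rewrite pnatr_eq0 -lt0n.
have z1 : zeta n ^+ n = 1.
  by rewrite /zeta -cisMn -[_ *+ n]mulr_natr divfK // cis2pi.
have [k kz kn] := prim_order_exists n0 z1.
have k0 := prim_order_gt0 kz.
have [nk|kn1] := eqVneq k n; first by rewrite -{1}nk.
have kn' : (k < n)%N by rewrite ltn_neqAle kn1 dvdn_leq.
have := prim_expr_order kz; rewrite /zeta -cisMn => /eqP; apply: contraTT => _.
have k0R : 0 < k%:R :> R by rewrite ltr0n.
have n0R : 0 < n%:R :> R by rewrite ltr0n.
have pi0 : 0 < pi *+ 2 :> R by rewrite pmulrn_rgt0 // pi_gt0.
apply: cis_neq1; rewrite -[_ *+ k]mulr_natr mulr_gt0 ?divr_gt0 //=.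
by rewrite mulrAC ltr_pdivrMr // ltr_pM2l // ltr_nat.
Qed.

Lemma cis_atan z : 0 < re z -> cis (atan (im z / re z)) = z / ofR (modulus z).
Proof.
move=> z0; have zn : re z != 0 by rewrite gt_eqF.
have m0 : 0 < modulus z by rewrite modulus_gt0; apply: contraTneq z0 => ->; rewrite ltxx.
have c : cos (atan (im z / re z)) = re z / modulus z.
  rewrite cos_atan -[RHS]invf_div; congr (_^-1).
  rewrite -[RHS]ger0_norm ?divr_ge0 ?ltW // -sqrtr_sqr; congr Num.sqrt.
  by rewrite !expr_div_n modulus_sqr mulrDl divff // sqrf_eq0.
have s : sin (atan (im z / re z)) = im z / modulus z.
  have := atanK (im z / re z); rewrite /tan c => /(canRL (divfK _)) ->.
    by rewrite mulrA divfK.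
  by rewrite mulf_neq0 // invr_eq0 gt_eqF.
rewrite /cis c s -fmorphV; apply: complexP; rewrite ?reM ?imM.
  by rewrite re_cplx re_ofR im_ofR; ring.
by rewrite im_cplx re_ofR im_ofR; ring.
Qed.

(** Dividing F by the k-th root [cis (pi *+ 2 / k%:R * theta t)] of the turning factor leaves a
    continuous function with k-th power w, hence a constant. *)
Lemma winding_root k (w : CC R) (theta : R -> R) (F : R -> CC R) :
    (0 < k)%N -> continuous F -> continuous theta -> theta 0 = 0 -> theta 1 = 1 ->
    (forall t, F t ^+ k = w * cis (pi *+ 2 * theta t)) ->
  F 1 = zeta k * F 0.
Proof.
move=> k0 cF ct t0 t1 Fk.
have kR : k%:R != 0 :> R by rewrite pnatr_eq0 -lt0n.
pose G t := F t / cis (pi *+ 2 / k%:R * theta t).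
have cG : continuous G.
  apply: continuous_div => [||t]; [exact: cF | | exact: cis_neq0].
  apply: continuous_cis => t; apply: cvgM; [exact: cvg_cst | exact: ct].
have Gk t : G t ^+ k = w.
  rewrite /G expr_div_n Fk -cisMn -[_ *+ k]mulr_natr.
  have -> : pi *+ 2 / k%:R * theta t * k%:R = pi *+ 2 * theta t by field.
  by rewrite mulfK // cis_neq0.
have := power_constant k0 cG Gk 0 1; rewrite /G t0 t1 mulr0 cis0 divr1 mulr1 => <-.
by rewrite mulrC -/(zeta k) divfK // cis_neq0.
Qed.

(* An m-th root of z^m w^n / |z^m w^n|, continuous in z != 0 and Re w > 0. *)
Definition root_turn m n z w : CC R :=
  z / ofR (modulus z) * cis (atan (im w / re w) * n%:R / m%:R).

Lemma root_turn_neq0 m n z w : z != 0 -> root_turn m n z w != 0.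
Proof.
move=> z0; rewrite mulf_neq0 ?cis_neq0 // mulf_neq0 // invr_eq0.
by rewrite modulusE normr_eq0.
Qed.

(** The m-th power of [root_turn m n (A t) (B t)] is A^m B^n divided by its modulus, so
    [winding_root] applies. Normalizing by the modulus leaves only angles to be divided by m. *)
Lemma winding_root_turn m n (w : CC R) (theta : R -> R) (A B : R -> CC R) :
    (0 < m)%N -> w != 0 -> continuous A -> continuous B ->
    (forall t, 0 < re (B t)) ->
    continuous theta -> theta 0 = 0 -> theta 1 = 1 ->
    (forall t, A t ^+ m * B t ^+ n = w * cis (pi *+ 2 * theta t)) ->
  root_turn m n (A 1) (B 1) = zeta m * root_turn m n (A 0) (B 0).
Proof.
move=> m0 w0 cA cB B0 ct t0 t1 AB.
have mR : m%:R != 0 :> R by rewrite pnatr_eq0 -lt0n.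
have A0 t : A t != 0.
  apply: contraTneq isT => At; have /esym/eqP := AB t.
  by rewrite At expr0n gtn_eqF //= mul0r mulf_eq0 (negPf w0) (negPf (cis_neq0 _)).
have mA0 t : ofR (modulus (A t)) != 0.
  by rewrite modulusE normr_eq0.
apply: (@winding_root m (w / ofR (modulus w)) theta
  (fun t => root_turn m n (A t) (B t))); [by [] | | exact: ct | exact: t0 | exact: t1 | ].
  apply: continuous_mul.
    apply: continuous_div => [||t]; last exact: mA0.
      exact: cA.
    by apply: continuous_ofR; apply: continuous_modulus; exact: cA.
  apply: continuous_cis => t.
  apply: cvgM; last exact: cvg_cst.
  apply: cvgM; last exact: cvg_cst.
  apply: (@continuous_comp _ _ _ (fun t => im (B t) / re (B t)));
    last exact: continuous_atan.
  apply: cvgM; first exact: (continuous_im cB).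
  by apply: cvgV; [rewrite gt_eqF | exact: (continuous_re cB)].
move=> t; rewrite /root_turn exprMn -cisMn -[_ *+ m]mulr_natr divfK //.
rewrite mulr_natr cisMn cis_atan // !expr_div_n mulrACA AB -invfM.
rewrite -!rmorphXn -rmorphM /= -!modulusX -modulusM AB modulusM modulus_cis.
by rewrite mulr1 mulrAC.
Qed.

End UnitCircle.

(** * Lifting paths through a polynomial away from its critical values *)

Section PathLifting.
Variable R : realType.
Local Open Scope ring_scope.
Implicit Types (p : {poly CC R}) (z w : CC R).

Lemma nonexpansive_continuous (f : R -> R) :
  (forall u v, `|f u - f v| <= `|u - v|) -> continuous f.
Proof.
move=> H t; apply/cvgrPdist_lt => e e0.
have /cvgrPdist_lt/(_ _ e0) := @cvg_id _ (nbhs t).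
by apply: filterS => s; apply: le_lt_trans.
Qed.

Lemma continuous_minr (a : R) : continuous (fun u : R => Num.min u a).
Proof.
apply: nonexpansive_continuous => u v; rewrite ler_norml.
have := ler_norm (v - u); rewrite distrC; have := ler_norm (u - v).
by case: (leP u a); case: (leP v a); lra.
Qed.

Lemma continuous_maxr (a : R) : continuous (fun u : R => Num.max a u).
Proof.
apply: nonexpansive_continuous => u v; rewrite ler_norml.
have := ler_norm (v - u); rewrite distrC; have := ler_norm (u - v).
by case: (leP a u); case: (leP a v); lra.
Qed.

(** Precomposing with this retraction extends a path on [0, 1] to all of R, so continuity can be
    stated globally. *)
Definition clamp (u : R) := Num.max 0 (Num.min u 1).

Lemma continuous_clamp : continuous clamp.
Proof.
move=> t; exact: (continuous_comp (@continuous_minr 1 t) (@continuous_maxr 0 _)).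
Qed.

Lemma clamp_id u : 0 <= u <= 1 -> clamp u = u.
Proof. by move=> /andP[u0 u1]; rewrite /clamp min_l // max_r. Qed.

Lemma clamp_itv u : 0 <= clamp u <= 1.
Proof. by rewrite /clamp le_max lexx ge_max ler01 ge_min lexx orbT. Qed.

Lemma clamp0 : clamp 0 = 0. Proof. by rewrite clamp_id // lexx ler01. Qed.
Lemma clamp1 : clamp 1 = 1. Proof. by rewrite clamp_id // lexx ler01. Qed.

Lemma clamp_le0 u : u <= 0 -> clamp u = 0.
Proof. by move=> h; rewrite /clamp min_l ?max_l //; lra. Qed.

Lemma clamp_ge1 u : 1 <= u -> clamp u = 1.
Proof. by move=> h; rewrite /clamp min_r ?max_r. Qed.

Lemma exists_le_prod (I : eqType) (f : I -> R) (s : seq I) :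
  s != [::] -> (forall i, 0 <= f i) ->
  exists2 i, i \in s & f i ^+ size s <= \prod_(j <- s) f j.
Proof.
move=> + f0; elim: s => [//|x [|y s] IH] _.
  by exists x; rewrite ?mem_head // big_seq1.
have [//|i is_ le_i] := IH; rewrite big_cons.
case: (leP (f x) (f i)) => h.
  exists x; rewrite ?mem_head // exprS ler_wpM2l // (le_trans _ le_i) //.
  by rewrite lerXn2r // nnegrE f0.
exists i; first by rewrite inE is_ orbT.
by rewrite exprS ler_pM // ?exprn_ge0 // ltW.
Qed.

Lemma uniq_simple_roots (s : seq (CC R)) (P := \prod_(r <- s) ('X - r%:P)) :
  (forall r, r \in s -> P^`().[r] != 0) -> uniq s.
Proof.
rewrite {}/P; elim: s => [//|x s IH]; rewrite big_cons.
set Q := \prod_(r <- s) _ in IH * => H.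
have D r : r \in s -> ((r - x) * Q^`().[r]) != 0.
  move=> rs; have := H r; rewrite inE rs orbT => /(_ isT).
  rewrite derivM hornerD derivXsubC mul1r [_.[r]](_ : Q.[r] = 0) ?add0r.
    by rewrite hornerM hornerXsubC.
  by apply/eqP; rewrite -/(root Q r) root_prod_XsubC.
rewrite /= IH ?andbT => [|r rs]; last by have := D r rs; rewrite mulf_eq0 => /norP[].
by apply/negP => xs; have := D x xs; rewrite subrr mul0r eqxx.
Qed.

Definition numbering p d w (e : 'I_d -> CC R) :=
  injective e /\ forall z, p.[z] = w <-> exists i, e i = z.

Section Degree.
Variables (p : {poly CC R}) (d : nat).
Hypotheses (sp : size p = d.+1) (d0 : (0 < d)%N).

Let lc_gt0 : 0 < modulus (lead_coef p).
Proof. by rewrite modulus_gt0 lead_coef_eq0 -size_poly_eq0 sp. Qed.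

Lemma size_subC w : size (p - w%:P) = d.+1.
Proof.
by rewrite size_polyDl ?sp // size_polyN (leq_ltn_trans (size_polyC_leq1 _)).
Qed.

Lemma lead_coef_subC w : lead_coef (p - w%:P) = lead_coef p.
Proof.
by rewrite lead_coefDl // size_polyN sp (leq_ltn_trans (size_polyC_leq1 _)).
Qed.

Lemma roots_subC w : exists2 s : seq (CC R), size s = d &
  p - w%:P = lead_coef p *: \prod_(r <- s) ('X - r%:P).
Proof.
have [s qE] := closed_field_poly_normal (p - w%:P).
rewrite lead_coef_subC in qE; exists s => //.
have := size_subC w; rewrite qE size_scale ?size_prod_XsubC; first by case.
by rewrite -modulus_gt0.
Qed.

(** The product of the distances from z to the roots of p - w, times the modulus of the leading
    coefficient, is the modulus of w - p(z); the root nearest to z satisfies the bound. *)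
Lemma nearby_root z w : exists2 y, p.[y] = w &
  modulus (lead_coef p) * modulus (z - y) ^+ d <= modulus (w - p.[z]).
Proof.
have [s ss qE] := roots_subC w.
have [|//|y ys yle] := @exists_le_prod _ (fun r => modulus (z - r)) s.
- by rewrite -size_eq0 ss -lt0n.
- by move=> r; exact: modulus_ge0.
exists y.
  apply/eqP; rewrite -subr_eq0 -(hornerC w y) -hornerN -hornerD qE hornerZ.
  by rewrite mulf_eq0 -/(root _ y) root_prod_XsubC ys orbT.
have -> : modulus (w - p.[z]) = modulus (lead_coef p) * \prod_(r <- s) modulus (z - r).
  rewrite modulus_distC -{1}(hornerC w z) -hornerN -hornerD qE hornerZ modulusM.
  rewrite horner_prod modulus_prod; congr (_ * _).
  by apply: eq_bigr => r _; rewrite !hornerE.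
by rewrite ler_pM2l // -[in X in _ ^+ X]ss.
Qed.

Lemma numbering_exists w :
  (forall z, p.[z] = w -> p^`().[z] != 0) -> exists e, numbering p w (e : 'I_d -> _).
Proof.
move=> sep; have [s ss qE] := roots_subC w.
have us : uniq s.
  apply: uniq_simple_roots => r rs.
  have pr : p.[r] = w.
    apply/eqP; rewrite -subr_eq0 -(hornerC w r) -hornerN -hornerD qE hornerZ.
    by rewrite mulf_eq0 -/(root _ r) root_prod_XsubC rs orbT.
  have := sep r pr; rewrite -[p^`()]subr0 -(derivC w) -derivB qE derivZ hornerZ.
  by rewrite mulf_eq0 => /norP[].
have sp' := lc_gt0; rewrite modulus_gt0 in sp'.
exists (fun i => s`_i); split.
  move=> i j /eqP; rewrite nth_uniq ?ss ?ltn_ord // => /eqP; exact: val_inj.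
move=> z; have -> : p.[z] = w <-> z \in s.
  rewrite -root_prod_XsubC /root -(mulrI_eq0 _ (mulfI sp')) -hornerZ -qE.
  by rewrite !hornerE subr_eq0; split => /eqP.
split=> [zs|[i <-]]; last by rewrite mem_nth // ss.
have h : (index z s < d)%N by rewrite -ss index_mem.
by exists (Ordinal h); rewrite /= nth_index.
Qed.

Lemma numbering_inj w (e : 'I_d -> CC R) :
  injective e -> (forall i, p.[e i] = w) -> numbering p w e.
Proof.
move=> ei pe; split=> // z; split=> [pz|[i <-]]; last exact: pe.
apply: contrapT => nz.
suff: (size (z :: codom e) < size (p - w%:P)%R)%N.
  by rewrite size_subC /= size_codom card_ord ltnn.
apply: max_poly_roots.
- by rewrite -size_poly_eq0 size_subC.
- rewrite /= /root !hornerE pz subrr eqxx; apply/allP => y /codomP[i ->].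
  by rewrite hornerD hornerN hornerC pe subrr eqxx.
- rewrite cons_uniq (introT (injectiveP e) ei : uniq (codom e)) andbT.
  by apply/codomP => -[i zi]; apply: nz; exists i.
Qed.

Lemma numbering_factor w (e : 'I_d -> CC R) z : numbering p w e ->
  p.[z] - w = lead_coef p * \prod_i (z - e i).
Proof.
move=> [ei pe].
have -> : p.[z] - w = (p - w%:P).[z] by rewrite !hornerE.
rewrite (@all_roots_prod_XsubC _ (p - w%:P) (codom e)).
- rewrite lead_coef_subC hornerZ horner_prod big_image /=; congr (_ * _).
  by apply: eq_bigr => i _; rewrite !hornerE.
- by rewrite size_subC size_codom card_ord.
- apply/allP => y /codomP[i ->]; rewrite /root !hornerE subr_eq0.
  by apply/eqP/pe; exists i.
- by rewrite uniq_rootsE; exact: (introT (injectiveP e) ei).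
Qed.

Lemma numbering_separated (e : 'I_d -> CC R) : injective e ->
  exists2 c : R, 0 < c & forall i j, i != j -> c <= modulus (e i - e j).
Proof.
move=> ei; have [c c0 Hc] := isolated [seq e x.1 - e x.2 | x : 'I_d * 'I_d] 0.
exists c => // i j ij; have := Hc (e i - e j).
rewrite subr0; apply; last by rewrite subr_eq0 (inj_eq ei).
by apply/mapP; exists (i, j); rewrite ?mem_enum.
Qed.

Lemma numbering_perm w (e f : 'I_d -> CC R) :
  numbering p w e -> injective f -> (forall i, p.[f i] = w) ->
  exists s : 'S_d, forall i, f i = e (s i).
Proof.
move=> [ei pe] fi pf.
have H i : exists j, e j == f i by have [j <-] := (pe (f i)).1 (pf i); exists j.
pose s i := xchoose (H i).
have sE i : e (s i) = f i by apply/eqP; exact: (xchooseP (H i)).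
have si : injective s by move=> i j sij; apply: fi; rewrite -!sE sij.
by exists (perm si) => i; rewrite permE sE.
Qed.

(** The branch s i picks a preimage within c / 4 of e i, where c separates the points of the fibre;
    distinct branches thus stay c / 2 apart. For the Lipschitz bound, write u - v as the leading
    coefficient times the product of the s i u - s j v: the d - 1 factors with j != i are at least c
    / 2 in modulus. *)
Lemma local_sections w (e : 'I_d -> CC R) : numbering p w e ->
  exists delta L : R, exists s : 'I_d -> CC R -> CC R,
  [/\ 0 < delta,
      forall i u, modulus (u - w) < delta -> p.[s i u] = u,
      forall u, modulus (u - w) < delta -> injective (s^~ u) &
      forall i u v, modulus (u - w) < delta -> modulus (v - w) < delta ->
        modulus (s i u - s i v) <= L * modulus (u - v)].
Proof.
move=> [ei pe]; have [c c0 Hc] := numbering_separated ei.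
have r0 : 0 < c / 4 by rewrite divr_gt0.
set r := c / 4 in r0; pose K := modulus (lead_coef p).
pose s i u := xget 0 [set y | p.[y] = u /\ modulus (e i - y) < r].
(* The first value is the distance from w below which [nearby_root] places a preimage within r of
   each e i. *)
exists (K * r ^+ d), (K * (c / 2) ^+ d.-1)^-1, s.
have sP i u : modulus (u - w) < K * r ^+ d ->
    p.[s i u] = u /\ modulus (e i - s i u) < r.
  move=> uw; apply: (@xgetPex _ 0 [set y | p.[y] = u /\ modulus (e i - y) < r]).
  have [y py Hy] := nearby_root (e i) u; exists y; split=> //.
  rewrite -(@ltr_pXn2r _ d) ?nnegrE ?modulus_ge0 ?(ltW r0) //.
  rewrite -(ltr_pM2l lc_gt0); apply: (le_lt_trans Hy).
  by rewrite ((pe (e i)).2 _) //; exists i.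
have sep i j u v : modulus (u - w) < K * r ^+ d -> modulus (v - w) < K * r ^+ d ->
    i != j -> c / 2 <= modulus (s i u - s j v).
  move=> uw vw ij; have [_ h1] := sP i u uw; have [_ h2] := sP j v vw.
  have := Hc _ _ ij; rewrite leNgt => /negP H; rewrite leNgt; apply/negP => h.
  apply: H; apply: (le_lt_trans (modulus_tri (s i u) _ _)).
  have := modulus_tri (s j v) (s i u) (e j); rewrite (modulus_distC (s j v) (e j)).
  move=> h3; rewrite /r in h1 h2; lra.
split.
- by rewrite mulr_gt0 ?exprn_gt0.
- by move=> i u /(sP i) [].
- move=> u uw i j sij; apply/eqP; apply: contraT => /(sep i j u u uw uw).
  rewrite sij subrr modulus0 //.
  by rewrite leNgt divr_gt0.
move=> i u v uw vw.
have nv : numbering p v (s^~ v).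
  apply: numbering_inj => [j k sjk|j]; last by have [] := sP j v vw.
  apply/eqP; apply: contraT => /(sep j k v v vw vw).
  rewrite sjk subrr modulus0 //.
  by rewrite leNgt divr_gt0.
have Kc : 0 < K * (c / 2) ^+ d.-1 by rewrite mulr_gt0 ?exprn_gt0 ?divr_gt0.
rewrite mulrC ler_pdivlMr //.
have := numbering_factor (s i u) nv; rewrite (sP i u uw).1 => ->.
rewrite modulusM modulus_prod (bigD1 i) //= mulrCA ler_wpM2l ?modulus_ge0 //.
rewrite ler_wpM2l ?modulus_ge0 //.
have -> : (c / 2) ^+ d.-1 = \prod_(j < d | j != i) (c / 2).
  by rewrite prodr_const cardC1 card_ord.
apply: ler_prod => j ji; rewrite divr_ge0 ?(ltW c0) //=.
by apply: (sep i j u v uw vw); rewrite eq_sym.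
Qed.

(** The lift follows g up to time a and then projects to the constant g a. Injectivity at each time
    makes its positions a numbering of the fibre, from which the extension starts. *)
Definition partial_lift (g : R -> CC R) (e : 'I_d -> CC R) (a : R)
    (H : 'I_d -> R -> CC R) :=
  [/\ forall i, continuous (H i),
      forall i u, p.[H i u] = g (clamp (Num.min u a)),
      forall i, H i 0 = e i &
      forall u, injective (H^~ u)].

(** Near t0 the path g stays in the domain of the local sections over g t0. The positions of H at
    time a are permuted section values, and the sections continue them to time b; eps depends on t0
    only. *)
Lemma partial_lift_extend (g : R -> CC R) e (t0 : R) : continuous g ->
  (forall z, p.[z] = g t0 -> p^`().[z] != 0) ->
  exists2 eps : R, 0 < eps & forall a b H,
    0 <= a -> a <= b -> b <= 1 -> `|a - t0| < eps -> `|b - t0| < eps ->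
    partial_lift g e a H -> exists H', partial_lift g e b H'.
Proof.
move=> cg sep; have [f nf] := numbering_exists sep.
have [delta [L [s [delta0 ps si sL]]]] := local_sections nf.
have /cvg_modulusP/(_ _ delta0) [eps /= eps0 geps] := cg t0.
exists eps => // a b H a0 ab b1 at0 bt0 [cH pH H0 Hi].
pose ball := [set u | modulus (u - g t0) < delta]%classic.
have gball u : `|u - t0| < eps -> ball (g u).
  by move=> ut0; apply: geps => /=; rewrite distrC.
have mid u : let v := Num.max a (Num.min u b) in `|v - t0| < eps.
  move=> v; have /andP[va vb] : a <= v <= b.
    by rewrite /v le_max lexx ge_max ab ge_min lexx orbT.
  by move: at0 bt0; rewrite !ltr_norml; lra.
have ga := gball a at0.
have nga : numbering p (g a) (s^~ (g a)).
  by apply: numbering_inj; [exact: si | move=> i; exact: ps].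
have Ha : forall i, p.[H i a] = g a.
  by move=> i; rewrite pH min_l // clamp_id // a0 (le_trans ab).
have [q qE] := numbering_perm nga (Hi a) Ha.
pose cl u := Num.max a (Num.min u b).
pose H' i u := H i (Num.min u a) + (s (q i) (g (cl u)) - s (q i) (g a)).
have ccl : continuous cl.
  move=> t; exact: (continuous_comp (@continuous_minr b t) (@continuous_maxr a _)).
have lo i u : u <= a -> H' i u = H i u.
  move=> ua; rewrite /H' /cl min_l // min_l ?max_l ?(le_trans ua) //.
  by rewrite subrr addr0.
have hi i u : a <= u -> H' i u = s (q i) (g (Num.min u b)).
  move=> ua; rewrite /H' /cl min_r // qE max_r ?le_min ?ua //.
  by rewrite addrC subrK.
exists H'; split.
- move=> i; apply: continuous_add.
    move=> t; apply: (continuous_comp (@continuous_minr a t)); exact: cH.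
  apply: continuous_sub; last exact: continuous_const.
  apply: (@continuous_lift _ _ _ ball L).
  + by move=> u v bu bv; apply: sL.
  + by move=> t; apply: gball; exact: mid.
  + move=> t; apply: (continuous_comp (ccl t)); exact: cg.
- move=> i u; case: (leP u a) => ua.
    by rewrite lo // pH min_l // min_l // (le_trans ua).
  have ub : a <= Num.min u b <= b by rewrite le_min (ltW ua) ab ge_min lexx orbT.
  rewrite hi ?ltW // ps; first by rewrite clamp_id //; lra.
  by apply: gball; move: at0 bt0 ub; rewrite !ltr_norml; lra.
- by move=> i; rewrite lo // H0.
- move=> u i j; case: (leP u a) => ua; first by rewrite !lo //; exact: Hi.
  rewrite !hi ?ltW // => /(si _ _ _ _) h; apply: (@perm_inj _ q); apply: h.
  have ub : a <= Num.min u b <= b by rewrite le_min (ltW ua) ab ge_min lexx orbT.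
  by apply: gball; move: at0 bt0 ub; rewrite !ltr_norml; lra.
Qed.

(** Continuous induction: let T be the supremum of the times up to which a lift exists; the
    extension around T reaches beyond T, unless it is stopped by 1. *)
Theorem path_lifting (g : R -> CC R) (e : 'I_d -> CC R) :
    continuous g -> (forall t z, p.[z] = g t -> p^`().[z] != 0) ->
    numbering p (g 0) e ->
  exists H : 'I_d -> R -> CC R,
  [/\ forall i, continuous (H i), forall i u, p.[H i u] = g (clamp u),
      forall i, H i 0 = e i & forall u, injective (H^~ u)].
Proof.
move=> cg sep [ei pe].
pose S := [set a | 0 <= a <= 1 /\ exists H, partial_lift g e a H]%classic.
have S0 : S 0.
  split; first by rewrite lexx ler01.
  exists (fun i _ => e i); split; [ | | by [] | by []].
  - by move=> i; exact: continuous_const.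
  - by move=> i u; rewrite clamp_le0 ?ge_min ?lexx ?orbT //; apply/pe; exists i.
have ubS : ubound S 1 by move=> a [/andP[]].
have hS : has_sup S by split; [exists 0 | exists 1].
pose T := sup S.
have T0 : 0 <= T by apply: ub_le_sup => //; exists 1.
have T1 : T <= 1 by apply: ge_sup => //; exists 0.
have [eps eps0 ext] := partial_lift_extend e cg (sep T).
have [a [/andP[a0 a1] [H HL]] Ta] := sup_adherent eps0 hS.
have aT : a <= T.
  by apply: ub_le_sup; [exists 1 | split; [rewrite a0 | exists H]].
pose b := Num.min 1 (T + eps / 2).
have hb : [/\ a <= b, b <= 1, `|a - T| < eps & `|b - T| < eps].
  rewrite -/T in Ta; rewrite /b; case: (leP 1 _) => h /=;
  by split; rewrite ?ltr_norml //; lra.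
have [ab b1 aTe bTe] := hb.
have [H' HL'] := ext _ _ _ a0 ab b1 aTe bTe HL.
have bT : b <= T.
  by apply: ub_le_sup; [exists 1 | split; [rewrite b1 (le_trans a0) | exists H']].
(* Otherwise b would be T + eps / 2, which exceeds T. *)
have {bT} bE : b = 1 by move: bT; rewrite /b; case: (leP 1 _) => h //= ; lra.
rewrite bE in HL'; have [cH pH H0 Hi] := HL'; exists H'.
split; [exact: cH | | exact: H0 | exact: Hi].
move=> i u; rewrite pH; congr (g _); rewrite /clamp.
by case: (leP u 1) => u1; rewrite min_l // ltW.
Qed.

End Degree.
End PathLifting.

(** * Simultaneous motion of a fibre and the permutations it induces *)

Lemma continuous_compose (S T U : topologicalType) (g : T -> U) (f : S -> T) :
  continuous f -> continuous g -> continuous (fun t => g (f t)).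
Proof. by move=> cf cg t; exact: (continuous_comp (cf t) (cg (f t))). Qed.

Section Moves.
Variable R : realType.
Local Open Scope ring_scope.
Variables (p : {poly CC R}) (d : nat).
Implicit Types (e : 'I_d -> CC R) (w : CC R).

(* The base path t |-> p.[H i t] is left implicit: it is common to all i. *)
Definition motion e e' (H : 'I_d -> R -> CC R) :=
  [/\ forall i, continuous (H i), forall i j t, p.[H i t] = p.[H j t],
      forall i t, p.[H i t] != 0 /\ p.[H i t] != 1,
      forall i, H i 0 = e i & forall i, H i 1 = e' i].

Definition moves e e' := exists H, motion e e' H.

Lemma moves_refl e w : (forall i, p.[e i] = w) -> w != 0 -> w != 1 -> moves e e.
Proof.
move=> pe w0 w1; exists (fun i _ => e i); split; [| | |by []|by []].
- by move=> i; exact: continuous_const.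
- by move=> i j _; rewrite !pe.
- by move=> i _; rewrite pe.
Qed.

Lemma moves_sym e e' : moves e e' -> moves e' e.
Proof.
move=> [H [cH pH nH H0 H1]]; exists (fun i t => H i (1 - t)); split.
- move=> i; apply: (@continuous_compose _ _ _ (H i) (fun t : R => 1 - t)); last exact: cH.
  by move=> t; apply: cvgB; [exact: cvg_cst | exact: cvg_id].
- by move=> i j t; exact: pH.
- by move=> i t; exact: nH.
- by move=> i; rewrite subr0; exact: H1.
- by move=> i; rewrite subrr; exact: H0.
Qed.

Lemma moves_trans e1 e2 e3 : moves e1 e2 -> moves e2 e3 -> moves e1 e3.
Proof.
move=> [H [cH pH nH H0 H1]] [K [cK pK nK K0 K1]].
(* The increment of K vanishes up to time 1 / 2, and H rests at e2 from then on, so the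
   concatenation is continuous as a sum. *)
pose F i t := H i (clamp (t *+ 2)) + (K i (clamp (t *+ 2 - 1)) - e2 i).
have lo i t : t <= 1 / 2 -> F i t = H i (clamp (t *+ 2)).
  move=> ht; rewrite /F (@clamp_le0 _ (t *+ 2 - 1)) ?K0 ?subrr ?addr0 //.
  by rewrite -mulr_natr; lra.
have hi i t : 1 / 2 <= t -> F i t = K i (clamp (t *+ 2 - 1)).
  move=> ht; rewrite /F (@clamp_ge1 _ (t *+ 2)) ?H1; first by rewrite addrC subrK.
  by rewrite -mulr_natr; lra.
have c2 : continuous (fun t : R => t *+ 2).
  by move=> t; apply: cvgD; exact: cvg_id.
exists F; split.
- move=> i; apply: continuous_add.
    apply: (@continuous_compose _ _ _ (H i) (fun t : R => clamp (t *+ 2))); last exact: cH.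
    exact: (continuous_compose c2 (@continuous_clamp R)).
  apply: continuous_sub; last exact: continuous_const.
  apply: (@continuous_compose _ _ _ (K i) (fun t : R => clamp (t *+ 2 - 1))); last exact: cK.
  apply: (@continuous_compose _ _ _ (@clamp R) (fun t : R => t *+ 2 - 1));
    last exact: continuous_clamp.
  by move=> t; apply: cvgB; [exact: c2 | exact: cvg_cst].
- move=> i j t; case: (leP t (1 / 2)) => ht; first by rewrite !lo.
  by rewrite !hi ?(ltW ht).
- move=> i t; case: (leP t (1 / 2)) => ht; first by rewrite lo.
  by rewrite hi ?(ltW ht).
- move=> i; rewrite lo; first by rewrite mul0rn clamp0 H0.
  by lra.
- move=> i; rewrite hi; last by lra.
  by rewrite mulr2n addrK clamp1 K1.
Qed.

Lemma moves_reindex e e' (s : 'S_d) :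
  moves e e' -> moves (e \o s) (e' \o s).
Proof.
move=> [H [cH pH nH H0 H1]]; exists (fun i => H (s i)); split.
- by move=> i; exact: cH.
- by move=> i j t; exact: pH.
- by move=> i t; exact: nH.
- by move=> i; exact: H0.
- by move=> i; exact: H1.
Qed.

Definition monodromy e : {set 'S_d} := [set s : 'S_d | `[< moves e (e \o s) >]]%SET.

Lemma monodromyP e (s : 'S_d) : reflect (moves e (e \o s)) (s \in monodromy e).
Proof. by rewrite inE; exact: asboolP. Qed.

Lemma monodromyM e (s u : 'S_d) :
  s \in monodromy e -> u \in monodromy e -> (s * u)%g \in monodromy e.
Proof.
move=> /monodromyP es /monodromyP eu; apply/monodromyP.
(* In a product the left factor acts first: after the motion for s, the motion for u is run with its
   points relabelled by s. *)
have -> : e \o (s * u)%g = (e \o u) \o s by apply: funext => i; rewrite /= permM.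
exact: moves_trans es (moves_reindex s eu).
Qed.

Lemma monodromyV e (s : 'S_d) : s \in monodromy e -> (s^-1)%g \in monodromy e.
Proof.
move=> /monodromyP es; apply/monodromyP.
have := moves_reindex (s^-1)%g (moves_sym es).
rewrite (_ : _ \o (s^-1)%g = e) //.
by apply: funext => i; rewrite /= permKV.
Qed.

Lemma monodromy1 e w :
  (forall i, p.[e i] = w) -> w != 0 -> w != 1 -> 1%g \in monodromy e.
Proof.
move=> pe w0 w1; apply/monodromyP.
rewrite (_ : e \o _ = e); last by apply: funext => i; rewrite /= perm1.
exact: moves_refl pe w0 w1.
Qed.

Lemma monodromy_transport e e' (s : 'S_d) :
  moves e e' -> s \in monodromy e -> s \in monodromy e'.
Proof.
move=> ee' /monodromyP es; apply/monodromyP.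
exact: moves_trans (moves_sym ee') (moves_trans es (moves_reindex s ee')).
Qed.

(** All lifts have the same image under p, so the ratio of f at two of them is a continuous k-th
    root of unity, hence constant. Cross-multiplying keeps division out of the statement. *)
Lemma moves_power_ratio (f : {poly CC R}) k (c : CC R) e e' : (0 < k)%N ->
    c != 0 -> f ^+ k = c *: p -> moves e e' ->
  forall i j, f.[e' i] * f.[e j] = f.[e' j] * f.[e i].
Proof.
move=> k0 c0 fk [H [cH pH nH H0 H1]] i j.
have fH h t : f.[H h t] ^+ k = c * p.[H h t].
  by rewrite -horner_exp fk hornerZ.
have f0 h t : f.[H h t] != 0.
  apply: contraTneq isT => fz; have := fH h t; rewrite fz expr0n gtn_eqF //=.
  by move/esym/eqP; rewrite mulf_eq0 (negPf c0) (negPf (nH h t).1).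
have cf h : continuous (fun t => f.[H h t]) by apply: continuous_poly; exact: cH.
have := @power_constant R k 1 (fun t => f.[H i t] / f.[H j t]) k0.
have cr : continuous (fun t => f.[H i t] / f.[H j t]).
  by apply: continuous_div; [exact: cf | exact: cf | exact: f0].
move=> /(_ cr) /(_ _ 0 1); rewrite !H0 !H1 => h.
have e1 : f.[e' i] / f.[e' j] = f.[e i] / f.[e j].
  apply: h => t; rewrite expr_div_n !fH (pH i j) divff // mulf_neq0 //.
  exact: (nH j t).1.
have n1 : f.[e' j] != 0 by rewrite -H1; exact: f0.
have n2 : f.[e j] != 0 by rewrite -H0; exact: f0.
by move/eqP: e1; rewrite eqr_div // => /eqP ->; rewrite mulrC.
Qed.

Hypotheses (sp : size p = d.+1) (d0 : (0 < d)%N).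
Hypothesis critical : forall z, p^`().[z] = 0 -> p.[z] = 0 \/ p.[z] = 1.

Lemma path_motion (g : R -> CC R) e : continuous g ->
    (forall t, g t != 0 /\ g t != 1) -> numbering p (g 0) e ->
  exists H e', [/\ motion e e' H, forall i t, p.[H i t] = g (clamp t) &
    numbering p (g 1) e'].
Proof.
move=> cg ng ne.
have sep t z : p.[z] = g t -> p^`().[z] != 0.
  move=> pz; apply/eqP => /critical; rewrite pz => -[] h.
    by have := (ng t).1; rewrite h eqxx.
  by have := (ng t).2; rewrite h eqxx.
have [H [cH pH H0 Hi]] := path_lifting sp d0 cg sep ne.
exists H, (fun i => H i 1); split; [split | exact: pH | ].
- exact: cH.
- by move=> i j t; rewrite !pH.
- by move=> i t; rewrite pH; exact: ng.
- exact: H0.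
- by [].
- by apply: numbering_inj => // i; rewrite pH clamp1.
Qed.

Lemma loop_motion (g : R -> CC R) e : continuous g ->
    (forall t, g t != 0 /\ g t != 1) -> g 1 = g 0 -> numbering p (g 0) e ->
  exists H (s : 'S_d), motion e (e \o s) H /\ forall i t, p.[H i t] = g (clamp t).
Proof.
move=> cg ng g10 ne; have [H [e' [mH pH [ie' pe']]]] := path_motion cg ng ne.
have [s sE] : exists s : 'S_d, forall i, e' i = e (s i).
  by apply: (numbering_perm ne ie') => i; rewrite -g10; apply/pe'; exists i.
exists H, s; split; last exact: pH.
case: mH => cH qH nH H0 H1.
by split; [exact: cH | exact: qH | exact: nH | exact: H0 | move=> i; rewrite H1 sE].
Qed.

End Moves.

(** * Derivative, degree and the double point over 1, over any field *)

Section DerivativeOfPolynomial.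
Variable F : fieldType.
Local Open Scope ring_scope.

Lemma deriv_binomial_product m n : (0 < m)%N -> (0 < n)%N ->
  (('X^m * (1 - 'X) ^+ n)^`() =
   'X^(m.-1) * (1 - 'X) ^+ n.-1 * (m%:R - (m + n)%:R * 'X) :> {poly F}).
Proof.
move=> m0 n0; rewrite derivM derivXn deriv_exp derivB derivX.
have -> : (1^`() = 0 :> {poly F}) by rewrite -polyC1 derivC.
have -> : ('X^m = 'X * 'X^(m.-1) :> {poly F}) by rewrite -exprS prednK.
have -> : ((1 - 'X) ^+ n = (1 - 'X) * (1 - 'X) ^+ n.-1 :> {poly F}).
  by rewrite -exprS prednK.
rewrite natrD -[_ *+ m]mulr_natr -[_ *+ n]mulr_natr.
ring.
Qed.

Lemma size_binomial_product m n :
  size ('X^m * (1 - 'X) ^+ n : {poly F}) = (m + n).+1.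
Proof.
have -> : (1 - 'X : {poly F}) = (-1) *: ('X - 1%:P).
  by rewrite scaleN1r opprB.
rewrite exprZn -scalerAr size_scale; last by rewrite expf_neq0 // oppr_eq0 oner_eq0.
rewrite size_monicM ?monicXn // ?size_polyXn ?size_exp_XsubC.
  by rewrite addSn /= addnS.
by rewrite -size_poly_eq0 size_exp_XsubC.
Qed.

(** The derivative has a simple zero at a, so p - 1 vanishes there to order exactly two. A multiple
    root of the cofactor Q is a critical point over 1 other than a. *)
Lemma double_point_factor (p S : {poly F}) a :
    (2%:R != 0 :> F) -> (p^`() = ('X - a%:P) * S) -> (S.[a] != 0) ->
    (p.[a] = 1) ->
  exists Q : {poly F},
  [/\ p - 1 = ('X - a%:P) ^+ 2 * Q, Q.[a] != 0 &
      forall r, Q.[r] = 0 -> Q^`().[r] = 0 -> [/\ p.[r] = 1, p^`().[r] = 0 & r != a]].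
Proof.
move=> two ES Sa pa.
have d1 : (p - 1)^`() = p^`() by rewrite derivB -polyC1 derivC subr0.
have /factor_theorem [Q1 E1] : root (p - 1) a by rewrite /root !hornerE pa subrr.
have dp : (p^`() = Q1^`() * ('X - a%:P) + Q1).
  by rewrite -d1 E1 derivM derivXsubC mulr1.
have /factor_theorem [Q E2] : root Q1 a.
  have := congr1 (fun q : {poly F} => q.[a]) dp; rewrite ES !hornerE subrr mul0r.
  by rewrite mulr0 add0r /root => <-.
have E : (p - 1 = ('X - a%:P) ^+ 2 * Q) by rewrite E1 E2; ring.
have dpE : (p^`() = ('X - a%:P) * ((2%:R * Q) + ('X - a%:P) * Q^`())).
  by rewrite -d1 E derivM deriv_exp derivXsubC mul1r expr1 -mulr_natl; ring.
have Qa : (Q.[a] != 0).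
  apply: contra Sa => /eqP Qa; move: dpE; rewrite ES => /mulfI ->.
    by rewrite !hornerE Qa subrr mul0r mulr0 addr0.
  by rewrite polyXsubC_eq0.
exists Q; split=> // r Qr Q'r; split.
- apply/eqP; rewrite -subr_eq0; have := congr1 (fun q : {poly F} => q.[r]) E.
  by rewrite !hornerE Qr mulr0 => ->.
- by rewrite dpE !hornerE Qr Q'r !mulr0 addr0 mulr0.
- by apply: contraNneq Qa => <-; rewrite Qr.
Qed.

End DerivativeOfPolynomial.

(** * The polynomial P_{m,n}: its critical points and its size on the line through the peak *)

Section Polynomial.
Variable R : realType.
Local Open Scope ring_scope.

Definition peak m n : R := m%:R / (m + n)%:R.

Definition scale_factor m n : R := (m + n)%:R ^+ (m + n) / (m%:R ^+ m * n%:R ^+ n).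

Definition Pmn_real m n (x : R) : R := scale_factor m n * (x ^+ m * (1 - x) ^+ n).

Lemma ofR_scale_factor m n : ofR (scale_factor m n) =
  ((m + n)%:R ^+ (m + n) / (m%:R ^+ m * n%:R ^+ n) : CC R).
Proof. by rewrite fmorph_div rmorphM !rmorphXn /= !rmorph_nat. Qed.

Lemma horner_Pmn m n (z : CC R) :
  (Pmn R m n).[z] = ofR (scale_factor m n) * (z ^+ m * (1 - z) ^+ n).
Proof. by rewrite ofR_scale_factor /Pmn !hornerE. Qed.

Lemma horner_Pmn_real m n (x : R) :
  (Pmn R m n).[ofR x] = ofR (Pmn_real m n x).
Proof.
by rewrite horner_Pmn /Pmn_real !rmorphM !rmorphXn /= rmorphB rmorph1.
Qed.

Variables m n : nat.
Hypotheses (m0 : (0 < m)%N) (n0 : (0 < n)%N).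

Lemma mnR : [/\ 0 < m%:R :> R, 0 < n%:R :> R & 0 < (m + n)%:R :> R].
Proof. by rewrite !ltr0n addn_gt0 m0. Qed.

Lemma scale_factor_gt0 : 0 < scale_factor m n.
Proof.
have [mR nR dR] := mnR.
by rewrite divr_gt0 ?mulr_gt0 ?exprn_gt0.
Qed.

Lemma scale_factorC_neq0 : ofR (scale_factor m n) != 0.
Proof.
by rewrite -(rmorph0 (@ofR R)) (inj_eq (@ofR_inj R)) gt_eqF // scale_factor_gt0.
Qed.

Lemma peak_itv : 0 < peak m n < 1.
Proof.
have [mR nR dR] := mnR.
by rewrite divr_gt0 //= ltr_pdivrMr // mul1r natrD ltrDl.
Qed.

Lemma Pmn_realE x : Pmn_real m n x =
  (x / peak m n) ^+ m * ((1 - x) / (1 - peak m n)) ^+ n.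
Proof.
have [mR nR dR] := mnR; rewrite /Pmn_real /scale_factor /peak natrD.
rewrite natrD in dR; set a := m%:R in mR dR *; set b := n%:R in nR dR *.
rewrite [1 - a / (a + b)](_ : _ = b / (a + b)); last by field; rewrite gt_eqF.
rewrite !expr_div_n exprD; field.
by rewrite !expf_neq0 ?gt_eqF.
Qed.

(** The weighted inequality of means, obtained from 1 + t <= exp t, strict for t != 0: with u = x /
    z0 and v = (1 - x) / (1 - z0), where z0 is the peak, the exponent m (u - 1) + n (v - 1) is
    zero. *)
Lemma Pmn_real_lt1 x : 0 <= x <= 1 -> x != peak m n -> Pmn_real m n x < 1.
Proof.
move=> /andP[x0 x1] xp; have [mR nR dR] := mnR.
have /andP[p0 p1] := peak_itv; rewrite Pmn_realE.
set u := x / _; set v := (1 - x) / _.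
have u0 : 0 <= u by rewrite divr_ge0 // ltW.
have v0 : 0 <= v by rewrite divr_ge0 ?subr_ge0 // ltW.
have q0 : 0 < 1 - peak m n by rewrite subr_gt0.
have u1 : u - 1 != 0.
  rewrite subr_eq0 /u; apply: contra xp => /eqP h.
  by rewrite -[x](divfK (lt0r_neq0 p0)) h mul1r.
have hu : u < expR (u - 1) by have := expR_gt1Dx u1; rewrite addrC subrK.
have hv : v <= expR (v - 1) by have := expR_ge1Dx (v - 1); rewrite addrC subrK.
have -> : 1 = expR (u - 1) ^+ m * expR (v - 1) ^+ n.
  rewrite -!expRM_natl -expRD -[LHS]expR0; congr expR.
  rewrite /u /v /peak natrD; rewrite natrD in dR.
  set a := m%:R in mR dR *; set b := n%:R in nR dR *.
  rewrite [1 - a / (a + b)](_ : _ = b / (a + b)); last by field; rewrite gt_eqF.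
  by field; rewrite !gt_eqF.
apply: (@le_lt_trans _ _ (u ^+ m * expR (v - 1) ^+ n)).
  by rewrite ler_wpM2l ?exprn_ge0 // lerXn2r // nnegrE // ltW ?expR_gt0.
rewrite ltr_pM2r ?exprn_gt0 ?expR_gt0 // ltr_pXn2r ?nnegrE ?expR_ge0 //.
Qed.

Lemma Pmn_real_peak : Pmn_real m n (peak m n) = 1.
Proof.
have /andP[p0 p1] := peak_itv.
by rewrite Pmn_realE !divff ?expr1n ?mulr1 ?subr_eq0 ?gt_eqF.
Qed.

Lemma horner_Pmn_peak : (Pmn R m n).[ofR (peak m n)] = 1.
Proof. by rewrite horner_Pmn_real Pmn_real_peak rmorph1. Qed.

(** On this line both |z| and |1 - z| are at least their values at the peak. So lifts of a loop
    inside the open unit disc cannot cross the line. *)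
Lemma modulus_Pmn_line z : re z = peak m n -> 1 <= modulus (Pmn R m n).[z].
Proof.
move=> rz; have /andP[p0 p1] := peak_itv.
have -> : 1 = scale_factor m n * (peak m n ^+ m * (1 - peak m n) ^+ n).
  by rewrite -[LHS]Pmn_real_peak.
rewrite horner_Pmn !modulusM !modulusX modulus_ofR gtr0_norm ?scale_factor_gt0 //.
rewrite ler_pM2l ?scale_factor_gt0 // ler_pM ?exprn_ge0 ?subr_ge0 ?(ltW p0) ?(ltW p1) //.
  rewrite lerXn2r ?nnegrE ?modulus_ge0 ?(ltW p0) //.
  by have := re_le_modulus z; rewrite rz gtr0_norm.
rewrite lerXn2r ?nnegrE ?modulus_ge0 ?subr_ge0 ?(ltW p1) //.
by have := re_le_modulus (1 - z); rewrite reB rz gtr0_norm ?subr_gt0.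
Qed.

Lemma size_Pmn : size (Pmn R m n) = (m + n).+1.
Proof.
rewrite /Pmn -ofR_scale_factor size_scale ?scale_factorC_neq0 //.
exact: size_binomial_product.
Qed.

Lemma deriv_Pmn : (Pmn R m n)^`() = ofR (scale_factor m n) *:
  ('X^(m.-1) * (1 - 'X) ^+ n.-1 * (m%:R - (m + n)%:R * 'X)).
Proof.
by rewrite /Pmn -ofR_scale_factor derivZ (deriv_binomial_product _ m0 n0).
Qed.

Lemma horner_deriv_Pmn z : (Pmn R m n)^`().[z] = ofR (scale_factor m n) *
  (z ^+ (m.-1) * (1 - z) ^+ n.-1 * (m%:R - (m + n)%:R * z)).
Proof. by rewrite deriv_Pmn !hornerE -!polyC_natr !hornerE. Qed.

Lemma ofR_peak : (m + n)%:R * ofR (peak m n) = m%:R.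
Proof.
have [mR nR dR] := mnR.
rewrite -[(m + n)%:R](rmorph_nat (@ofR R)) -rmorphM /= mulrC divfK ?gt_eqF //.
by rewrite rmorph_nat.
Qed.

Lemma critical_points z :
  (Pmn R m n)^`().[z] = 0 -> [\/ z = 0, z = 1 | z = ofR (peak m n)].
Proof.
have dC : (m + n)%:R != 0 :> CC R by rewrite pnatr_eq0 addn_eq0 eqn0Ngt m0.
rewrite horner_deriv_Pmn => /eqP.
rewrite !mulf_eq0 (negPf scale_factorC_neq0) /=.
move=> /orP[/orP[]|]; rewrite ?expf_eq0.
- by move=> /andP[_ /eqP ->]; apply: Or31.
- by move=> /andP[_]; rewrite subr_eq0 => /eqP <-; apply: Or32.
- by rewrite -ofR_peak -mulrBr mulf_eq0 (negPf dC) subr_eq0 => /eqP <-; apply: Or33.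
Qed.

Lemma critical_values z : (Pmn R m n)^`().[z] = 0 ->
  (Pmn R m n).[z] = 0 \/ (Pmn R m n).[z] = 1.
Proof.
move=> /critical_points [->|->|->].
- by left; rewrite horner_Pmn expr0n gtn_eqF //= mul0r mulr0.
- by left; rewrite horner_Pmn subrr expr0n (gtn_eqF n0) !mulr0.
- by right; rewrite horner_Pmn_peak.
Qed.

Lemma Pmn_sub1 : exists Q : {poly CC R},
  [/\ Pmn R m n - 1 = ('X - (ofR (peak m n))%:P) ^+ 2 * Q,
      Q.[ofR (peak m n)] != 0 &
      forall r, Q.[r] = 0 -> Q^`().[r] != 0].
Proof.
have /andP[k0 k1] := peak_itv.
set a := ofR (peak m n); set p := Pmn R m n.
have [S ES Sa] : exists2 S : {poly CC R}, p^`() = ('X - a%:P) * S & S.[a] != 0.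
  exists (- (ofR (scale_factor m n) * (m + n)%:R) *: ('X^(m.-1) * (1 - 'X) ^+ n.-1)).
    rewrite /p deriv_Pmn -[m%:R]polyC_natr -ofR_peak -/a polyCM polyC_natr -mulrBr.
    by rewrite -!mul_polyC polyCN polyCM polyC_natr; ring.
  rewrite hornerZ hornerM !horner_exp hornerD hornerN hornerX -polyC1 hornerC mulf_neq0 //.
    rewrite oppr_eq0 mulf_neq0 ?scale_factorC_neq0 //.
    by rewrite pnatr_eq0 addn_eq0 eqn0Ngt m0.
  rewrite mulf_neq0 ?expf_neq0 // ?subr_eq0.
    by rewrite -(rmorph0 (@ofR R)) (inj_eq (@ofR_inj R)) gt_eqF.
  by rewrite -(rmorph1 (@ofR R)) (inj_eq (@ofR_inj R)) gt_eqF.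
have [|Q [EQ Qa H]] := double_point_factor _ ES Sa (horner_Pmn_peak : p.[a] = 1).
  by rewrite pnatr_eq0.
exists Q; split=> // r Qr; apply/eqP => /(H r Qr) [pr p'r ra].
case: (critical_points p'r) => rE; last by rewrite rE eqxx in ra.
  move: pr; rewrite rE horner_Pmn expr0n gtn_eqF //= mul0r mulr0 => /esym/eqP.
  by rewrite oner_eq0.
move: pr; rewrite rE horner_Pmn subrr expr0n (gtn_eqF n0) !mulr0 => /esym/eqP.
by rewrite oner_eq0.
Qed.

End Polynomial.

(** * The loop around 0 *)

Section RotationAroundZero.
Variable R : realType.
Local Open Scope ring_scope.
Variables (m n : nat).
Hypotheses (m0 : (0 < m)%N) (n0 : (0 < n)%N).
Local Notation p := (Pmn R m n).
Local Notation z0 := (peak R m n).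
Implicit Types (e : 'I_(m + n) -> CC R).

Let d0 : (0 < m + n)%N. Proof. by rewrite addn_gt0 m0. Qed.

Lemma side_of_peak e (b : R) : 0 < b < 1 -> numbering p (ofR b) e ->
  forall i, re (e i) != z0.
Proof.
move=> /andP[b0 b1] [ei pe] i; apply/eqP => /(modulus_Pmn_line m0 n0).
rewrite (_ : p.[e i] = ofR b); last by apply/pe; exists i.
by rewrite modulus_ofR gtr0_norm // leNgt b1.
Qed.

(** The loop is the circle of radius b. Each lift stays on its side of the line through the peak: on
    the left 1 - z has positive real part, on the right z has, so on either side one of the two
    forms of [root_turn] is continuous along the lift and [winding_root_turn] computes its change.
    The last clause, for polynomial roots of p, needs no side. *)
Lemma rotation_around_zero e (b : R) : 0 < b < 1 -> numbering p (ofR b) e ->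
  exists2 s : 'S_(m + n), s \in monodromy p e &
  [/\ forall i, (re (e (s i)) < z0) = (re (e i) < z0),
      forall i, re (e i) < z0 ->
        root_turn m n (e (s i)) (1 - e (s i)) =
        zeta R m * root_turn m n (e i) (1 - e i),
      forall i, z0 < re (e i) ->
        root_turn n m (1 - e (s i)) (e (s i)) =
        zeta R n * root_turn n m (1 - e i) (e i) &
      forall (f : {poly CC R}) k c, (0 < k)%N -> f ^+ k = c *: p ->
        forall i, f.[e (s i)] = zeta R k * f.[e i]].
Proof.
move=> b01 ne; have /andP[b0 b1] := b01.
have /andP[k0 k1] := peak_itv R m0 n0.
pose g t : CC R := ofR b * cis (pi *+ 2 * t).
have mg t : modulus (g t) = b.
  by rewrite modulusM modulus_cis mulr1 modulus_ofR gtr0_norm.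
have cg : continuous g.
  apply: continuous_mul; first exact: continuous_const.
  by apply: continuous_cis => t; apply: cvgM; [exact: cvg_cst | exact: cvg_id].
have ng t : g t != 0 /\ g t != 1.
  split; first by rewrite -modulus_eq0 mg gt_eqF.
  apply/eqP => /(congr1 (@modulus R)); rewrite mg.
  by rewrite -(rmorph1 (@ofR R)) modulus_ofR normr1 => bE; rewrite bE ltxx in b1.
have g00 : g 0 = ofR b by rewrite /g mulr0 cis0 mulr1.
have g10 : g 1 = g 0 by rewrite g00 /g mulr1 cis2pi mulr1.
have ne' : numbering p (g 0) e by rewrite g00.
have [H [s [[cH pH nH H0 H1] HE]]] :=
  loop_motion (size_Pmn R m0 n0) d0 (@critical_values R m n m0 n0) cg ng g10 ne'.
have Hn i t : re (H i t) != z0.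
  apply/eqP => /(modulus_Pmn_line m0 n0).
  by rewrite HE mg leNgt b1.
have cre i : continuous (fun t => re (H i t)) by apply: continuous_re; exact: cH.
have left i : re (e i) < z0 -> forall t, re (H i t) < z0.
  move=> ei; apply: (@stays_below _ (fun t => re (H i t)) z0 0).
  - exact: cre.
  - exact: Hn.
  - by rewrite H0.
have right i : z0 < re (e i) -> forall t, z0 < re (H i t).
  move=> ei t; rewrite -ltrN2; apply: (@stays_below _ (fun t => - re (H i t)) (- z0) 0).
  - by move=> u; apply: cvgN; exact: cre.
  - by move=> u; rewrite eqr_opp; exact: Hn.
  - by rewrite H0 ltrN2.
exists s; first by apply/monodromyP; exists H.
have ct : continuous (@clamp R) by exact: continuous_clamp.
have [c0 c1] := (clamp0 R, clamp1 R).
have r0 : ofR (b / scale_factor R m n) != 0.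
  rewrite -modulus_eq0 modulus_ofR normr_eq0 mulf_neq0 ?invr_eq0 ?gt_eqF //.
  exact: scale_factor_gt0.
have Hw i t : H i t ^+ m * (1 - H i t) ^+ n =
    ofR (b / scale_factor R m n) * cis (pi *+ 2 * clamp t).
  have := HE i t; rewrite horner_Pmn /g => hE.
  rewrite -[LHS](mulKf (scale_factorC_neq0 R m0 n0)) hE [ofR (b / _)]fmorph_div /=.
  by rewrite mulrA; congr (_ * _); rewrite mulrC.
split.
- move=> i; apply/idP/idP => ei; last by have := left i ei 1; rewrite H1.
  rewrite ltNge le_eqVlt; apply/negP => /orP[/eqP ei'|/right/(_ 1)].
    by have := Hn i 0; rewrite H0 -ei' eqxx.
  by rewrite H1 => /(lt_trans ei); rewrite ltxx.
- move=> i ei; have := @winding_root_turn R m n _ _ (H i) (fun t => 1 - H i t) m0 r0.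
  rewrite H0 H1; apply; [exact: cH | | | exact: ct | exact: c0 | exact: c1 | exact: Hw].
    by apply: continuous_sub; [exact: continuous_const | exact: cH].
  move=> t; rewrite reB re1 subr_gt0; apply: lt_trans k1; exact: left.
- move=> i ei; have := @winding_root_turn R n m _ _ (fun t => 1 - H i t) (H i) n0 r0.
  rewrite H0 H1; apply; [| exact: cH | | exact: ct | exact: c0 | exact: c1 | ].
  + by apply: continuous_sub; [exact: continuous_const | exact: cH].
  + by move=> t; apply: lt_trans k0 _; exact: right.
  + by move=> t; rewrite mulrC; exact: Hw.
- move=> f k c kk fk i.
  have := @winding_root R k (c * ofR b) (@clamp R) (fun t => f.[H i t]) kk.
  rewrite H0 H1; apply; [| exact: ct | exact: c0 | exact: c1 | ].
    by apply: continuous_poly; exact: cH.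
  by move=> t; rewrite -horner_exp fk hornerZ HE /g mulrA.
Qed.

End RotationAroundZero.

(** * The loop around 1 *)

Section TranspositionAroundOne.
Variable R : realType.
Local Open Scope ring_scope.
Variables (m n : nat).
Hypotheses (m0 : (0 < m)%N) (n0 : (0 < n)%N).
Local Notation p := (Pmn R m n).
Local Notation z0 := (peak R m n).
Local Notation c0 := (ofR z0).
Local Notation K := (modulus (lead_coef p)).

Let d0 : (0 < m + n)%N. Proof. by rewrite addn_gt0 m0. Qed.

Let K0 : 0 < K.
Proof. by rewrite modulus_gt0 lead_coef_eq0 -size_poly_eq0 size_Pmn. Qed.

(** The peak counts twice in the fibre over 1, and the other m + n - 2 points are simple. *)
Lemma roots_Pmn_sub1 (Q : {poly CC R}) : p - 1 = ('X - c0%:P) ^+ 2 * Q ->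
    Q.[c0] != 0 -> (forall r, Q.[r] = 0 -> Q^`().[r] != 0) ->
  exists2 rs : seq (CC R), uniq (c0 :: rs) /\ (size rs).+2 = (m + n)%N &
    forall r, p.[r] = 1 <-> r \in c0 :: rs.
Proof.
move=> E Qc sQ.
have Q0 : Q != 0 by apply: contraNneq Qc => ->; rewrite horner0.
have [rs QE] := closed_field_poly_normal Q.
have lQ : lead_coef Q != 0 by rewrite lead_coef_eq0.
have Qrs r : (r \in rs) = (Q.[r] == 0).
  by rewrite -/(root Q r) QE rootZ // root_prod_XsubC.
exists rs; first split.
- rewrite cons_uniq Qrs Qc /=; apply: uniq_simple_roots => r.
  rewrite Qrs => /eqP /sQ; rewrite {1}QE derivZ hornerZ mulf_eq0 => /norP[_].
  by [].
- have := size_subC (size_Pmn R m0 n0) d0 1; rewrite polyC1 E.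
  rewrite size_monicM ?monic_exp ?monicXsubC // size_exp_XsubC QE size_scale //.
  by rewrite size_prod_XsubC => -[].
- move=> r; rewrite inE Qrs.
  have -> : p.[r] = 1 <-> (p - 1).[r] == 0.
    by rewrite hornerD hornerN -polyC1 hornerC subr_eq0; split=> /eqP.
  rewrite E hornerM horner_exp hornerXsubC mulf_eq0 expf_eq0 /= subr_eq0.
  by split.
Qed.

(** The radius is small enough to isolate the points of rs, to keep the real points near the peak in
    (0, 1), and to keep Q(z) / Q(c0) in the right half-plane, where [root_turn] supplies a
    continuous square root. *)
Lemma disc_radius (Q : {poly CC R}) (rs : seq (CC R)) : Q.[c0] != 0 ->
  exists eta : R,
  [/\ 0 < eta, eta < z0 /\ eta < 1 - z0,
    forall r r', r \in rs -> r' \in rs -> r != r' -> eta *+ 4 <= modulus (r - r') &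
    forall z, modulus (z - c0) < eta -> 0 < re (Q.[z] / Q.[c0])].
Proof.
move=> Qc; have /andP[k0 k1] := peak_itv R m0 n0.
have [c c_gt0 Hc] := isolated [seq r - r' | r <- rs, r' <- rs] 0.
have cQ : continuous (fun z : CC R => Q.[z]).
  by apply: continuous_poly => z; exact: cvg_id.
have Qc' : 0 < modulus Q.[c0] by rewrite modulus_gt0.
have [e e0 He] : exists2 e : R, 0 < e & forall z : CC R, modulus (z - c0) < e ->
    modulus (Q.[z] - Q.[c0]) < modulus Q.[c0].
  have /cvg_modulusP/(_ _ Qc') := cQ c0.
  move=> /nbhs_ballP [e /= e0 He].
  exists (re e).
    by move: e0; rewrite ltcE => /andP[].
  have eE : e = ofR (re e).
    by apply: complexP; rewrite ?re_ofR ?im_ofR //; move: e0; rewrite ltcE => /andP[/eqP].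
  move=> z hz; apply: He; rewrite -ball_normE /= eE -modulusE ltr_ofR.
  by rewrite modulus_distC.
pose eta := Num.min (Num.min (c / 4) e) (Num.min (z0 / 2) ((1 - z0) / 2)).
have h1 : eta <= c / 4 by rewrite /eta !ge_min lexx.
have h2 : eta <= e by rewrite /eta !ge_min lexx orbT.
have h3 : eta <= z0 / 2 by rewrite /eta !ge_min lexx !orbT.
have h4 : eta <= (1 - z0) / 2 by rewrite /eta !ge_min lexx !orbT.
exists eta; split.
- have q0 : 0 < 1 - z0 by rewrite subr_gt0.
  rewrite /eta !lt_min e0 (divr_gt0 c_gt0) // (divr_gt0 k0) //.
  by rewrite (divr_gt0 q0).
- by split; lra.
- move=> r r' rr rr' nrr; have := Hc (r - r').
  rewrite subr0 subr_eq0 nrr -mulr_natr => /(_ _ isT) h.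
  suff : c <= modulus (r - r') by lra.
  by apply: h; apply/allpairsP; exists (r, r').
- move=> z hz; have := He z (lt_le_trans hz h2) => hQ.
  have -> : Q.[z] / Q.[c0] = 1 + (Q.[z] - Q.[c0]) / Q.[c0] by field.
  rewrite reD re1 -ltrBlDl sub0r; set u := _ / _.
  have hu : modulus u < 1.
    rewrite -(ltr_pM2r Qc') mul1r -modulusM /u divfK //.
  by have := re_le_modulus u; rewrite ler_norml => /andP[]; lra.
Qed.

Lemma real_fibre_point (a b' b : R) : a <= b' ->
  Num.min (Pmn_real m n a) (Pmn_real m n b') <= b ->
  b <= Num.max (Pmn_real m n a) (Pmn_real m n b') ->
  exists2 x : R, a <= x <= b' & p.[ofR x] = ofR b.
Proof.
move=> ab hb1 hb2.
have [x xab Hx] : exists2 x, x \in `[a, b'] & Pmn_real m n x = b.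
  apply: IVT; [exact: ab | | by rewrite hb1].
  apply: continuous_subspaceT => t.
  have -> : Pmn_real m n = fun x => re p.[ofR x].
    by apply: funext => x; rewrite horner_Pmn_real re_ofR.
  apply: continuous_re; apply: continuous_poly; apply: continuous_ofR => u.
  exact: cvg_id.
exists x; first by move: xab; rewrite in_itv.
by rewrite horner_Pmn_real Hx.
Qed.

(** At a point at distance exactly eta from r, [nearby_root] would give a point over 1 closer than
    eta: it would not be r, yet within 2 eta of r, against the separation. *)
Lemma stays_in_disc (rs : seq (CC R)) (eta : R) (H : R -> CC R) r :
    (forall r, p.[r] = 1 <-> r \in rs) -> 0 < eta -> r \in rs ->
    (forall r r', r \in rs -> r' \in rs -> r != r' -> eta *+ 4 <= modulus (r - r')) ->
    continuous H -> (forall t, modulus (1 - p.[H t]) < K * eta ^+ (m + n)) ->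
    modulus (H 0 - r) < eta ->
  forall t, modulus (H t - r) < eta.
Proof.
move=> prs eta0 rrs sep cH Hlt H0.
apply: (@stays_below _ (fun t => modulus (H t - r)) eta 0); last exact: H0.
  by apply: continuous_modulus; apply: continuous_sub; [exact: cH | exact: continuous_const].
move=> t; apply/eqP => Ht.
have [y py Hy] := nearby_root (size_Pmn R m0 n0) d0 (H t) 1.
have Hye : modulus (H t - y) < eta.
  rewrite -(@ltr_pXn2r _ (m + n)) ?nnegrE ?modulus_ge0 ?(ltW eta0) //.
  by rewrite -(ltr_pM2l K0); exact: le_lt_trans Hy (Hlt t).
have [ry|nry] := eqVneq r y; first by rewrite -ry Ht ltxx in Hye.
have := sep r y rrs ((prs y).1 py) nry.
have := modulus_tri (H t) r y; rewrite (modulus_distC r (H t)) Ht -mulr_natr; lra.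
Qed.

(** Lifts of the small circle about 1 through b stay in the eta-discs around the points over 1. A
    disc around a simple point holds a single fibre point, which is fixed; the disc around the peak
    holds the two real points x and y, which are exchanged because z - c0 changes sign. *)
Lemma transposition_around_one : exists2 b0 : R, 0 <= b0 < 1 &
  forall b e, b0 < b < 1 -> numbering p (ofR b) (e : 'I_(m + n) -> CC R) ->
  exists i j (x y : R), [/\ tperm i j \in monodromy p e,
    e i = ofR x /\ e j = ofR y, 0 < x < z0 & z0 < y < 1].
Proof.
have /andP[k0 k1] := peak_itv R m0 n0.
have [Q [E Qc sQ]] := Pmn_sub1 R m0 n0.
have [rs [urs srs] prs] := roots_Pmn_sub1 E Qc sQ.
have [eta [eta0 [eta_z eta_1z] sep reQ]] := disc_radius (c0 :: rs) Qc.
set q1 := Pmn_real m n (z0 - eta / 2); set q2 := Pmn_real m n (z0 + eta / 2).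
have q11 : q1 < 1.
  apply: Pmn_real_lt1 => //; first by lra.
  by rewrite lt_eqF //; lra.
have q21 : q2 < 1.
  apply: Pmn_real_lt1 => //; first by lra.
  by rewrite gt_eqF //; lra.
have Ke : 0 < K * eta ^+ (m + n) by rewrite mulr_gt0 ?exprn_gt0.
(* Above q1 and q2, the intermediate value theorem finds real fibre points within eta / 2 of the
   peak on either side; above the last bound, lifts of the circle of radius 1 - b stay in the
   discs. *)
exists (Num.max (Num.max 0 q1) (Num.max q2 (1 - K * eta ^+ (m + n)))).
  rewrite !le_max lexx /= !gt_max ltr01 q11 q21 /=.
  by rewrite ltrBlDr ltrDl.
move=> b e /andP[]; rewrite !gt_max => /andP[/andP[b0 bq1] /andP[bq2 bK]] b1 ne.
have [ei pe] := ne.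
have [x hx px] : exists2 x : R, z0 - eta / 2 <= x <= z0 & p.[ofR x] = ofR b.
  apply: real_fibre_point; first by lra.
    by rewrite ge_min -/q1 (ltW bq1).
  by rewrite le_max Pmn_real_peak // (ltW b1) orbT.
have [y hy py] : exists2 y : R, z0 <= y <= z0 + eta / 2 & p.[ofR y] = ofR b.
  apply: real_fibre_point; first by lra.
    by rewrite ge_min -/q2 (ltW bq2) orbT.
  by rewrite le_max Pmn_real_peak // (ltW b1).
have npeak w : p.[ofR w] = ofR b -> w != z0.
  move=> pw; apply: contraTneq b1 => wz; move: pw; rewrite wz horner_Pmn_peak //.
  by rewrite -(rmorph1 (@ofR R)) => /(@ofR_inj R) ->; rewrite ltxx.
have xz : x < z0 by rewrite lt_neqAle npeak //; case/andP: hx.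
have zy : z0 < y by rewrite lt_neqAle eq_sym npeak //; case/andP: hy.
have [ix eix] := (pe _).1 px; have [iy eiy] := (pe _).1 py.
have ixy : ix != iy.
  apply/eqP => h; move: eix; rewrite h eiy => /(@ofR_inj R) yx.
  by move: (lt_trans xz zy); rewrite yx ltxx.
have nearx : modulus (e ix - c0) < eta.
  rewrite eix -rmorphB modulus_ofR ltr0_norm ?subr_lt0 //.
  by move/andP: hx; lra.
have neary : modulus (e iy - c0) < eta.
  rewrite eiy -rmorphB modulus_ofR gtr0_norm ?subr_gt0 //.
  by move/andP: hy; lra.
(* The fibre point near r; for r over 1 the search succeeds, so the default [ix] is not reached. *)
pose F r := odflt ix [pick i | modulus (e i - r) < eta].
have FP r : r \in c0 :: rs -> modulus (e (F r) - r) < eta.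
  move=> /prs pr; rewrite /F; case: pickP => //= none.
  have [z pz Hz] := nearby_root (size_Pmn R m0 n0) d0 r (ofR b).
  have [i ez] := (pe z).1 pz; have := none i; rewrite ez => /negP[].
  rewrite modulus_distC -(@ltr_pXn2r _ (m + n)) ?nnegrE ?modulus_ge0 ?(ltW eta0) //.
  rewrite -(ltr_pM2l K0); apply: (le_lt_trans Hz); rewrite pr.
  rewrite -(rmorph1 (@ofR R)) -rmorphB modulus_ofR ltr0_norm ?subr_lt0 //.
  by move: bK; lra.
have Funiq i r r' : r \in c0 :: rs -> r' \in c0 :: rs ->
    modulus (e i - r) < eta -> modulus (e i - r') < eta -> r = r'.
  move=> rr rr' h h'; apply/eqP; apply: contraT => /(sep r r' rr rr').
  have := modulus_tri (e i) r r'; rewrite (modulus_distC r (e i)) -mulr_natr; lra.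
have c0rs : c0 \in c0 :: rs by rewrite mem_head.
have rsS r : r \in rs -> r \in c0 :: rs by rewrite inE => ->; rewrite orbT.
have notF r i : r \in rs -> modulus (e i - c0) < eta -> i != F r.
  move=> rr h; apply/eqP => iF; rewrite iF in h.
  have rc := Funiq _ _ _ (rsS r rr) c0rs (FP r (rsS r rr)) h.
  by move: urs; rewrite cons_uniq -rc rr.
(* These are m + n distinct indices, hence all of them. *)
have cover i : i \in [:: ix, iy & [seq F r | r <- rs]].
  apply: contraT => nin.
  have : uniq (i :: [:: ix, iy & [seq F r | r <- rs]]).
    rewrite cons_uniq nin /= inE (negPf ixy) /=.
    move: urs => /= /andP[_ urs]; rewrite map_inj_in_uniq ?urs ?andbT.
      apply/andP; split; apply/mapP => -[r rr /eqP]; apply/negP; exact: notF.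
    move=> r r' rr rr' Frr'; apply: (Funiq (F r)); rewrite ?rsS //.
      exact/FP/rsS.
    by rewrite Frr'; exact/FP/rsS.
  move=> /card_uniqP /eqP; rewrite /= size_map srs => hc.
  have := max_card (mem (i :: [:: ix, iy & [seq F r | r <- rs]])).
  by rewrite (eqP hc) card_ord ltnn.
pose g t : CC R := 1 - ofR (1 - b) * cis (pi *+ 2 * t).
have mg t : modulus (1 - g t) = 1 - b.
  rewrite /g opprB addrC subrK modulusM modulus_cis mulr1 modulus_ofR.
  by rewrite gtr0_norm // subr_gt0.
have cg : continuous g.
  apply: continuous_sub; first exact: continuous_const.
  apply: continuous_mul; first exact: continuous_const.
  by apply: continuous_cis => t; apply: cvgM; [exact: cvg_cst | exact: cvg_id].
have ng t : g t != 0 /\ g t != 1.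
  split; apply/eqP => gt; have := mg t; rewrite gt.
    rewrite subr0 -(rmorph1 (@ofR R)) modulus_ofR normr1; lra.
  by rewrite subrr modulus0 //; lra.
have g00 : g 0 = ofR b.
  by rewrite /g mulr0 cis0 mulr1 rmorphB rmorph1 opprB addrC subrK.
have g10 : g 1 = g 0 by rewrite /g mulr1 mulr0 cis2pi cis0.
have ne' : numbering p (g 0) e by rewrite g00.
have [H [s [[cH pH nH H0 H1] HE]]] :=
  loop_motion (size_Pmn R m0 n0) d0 (@critical_values R m n m0 n0) cg ng g10 ne'.
have stay i r : r \in c0 :: rs -> modulus (e i - r) < eta ->
    forall t, modulus (H i t - r) < eta.
  move=> rr h; apply: (stays_in_disc prs eta0 rr sep (cH i)).
    by move=> t; rewrite HE mg; move: bK; lra.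
  by rewrite H0.
have sfix r : r \in rs -> s (F r) = F r.
  move=> rr; have rr' := rsS r rr.
  have h := stay (F r) r rr' (FP r rr') 1; rewrite H1 /= in h.
  have /or3P[/eqP sE|/eqP sE|/mapP[r' r'r sE]] :
    [|| s (F r) == ix, s (F r) == iy | s (F r) \in [seq F r | r <- rs]].
  + by have := cover (s (F r)); rewrite !inE.
  + by rewrite sE in h; move: urs; rewrite cons_uniq (Funiq _ _ _ c0rs rr' nearx h) rr.
  + by rewrite sE in h; move: urs; rewrite cons_uniq (Funiq _ _ _ c0rs rr' neary h) rr.
  + rewrite sE in h; rewrite sE; congr F.
    exact: (Funiq _ _ _ (rsS r' r'r) rr' (FP r' (rsS r' r'r)) h).
have snear i : modulus (e i - c0) < eta -> s i = ix \/ s i = iy.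
  move=> h; have := cover (s i); rewrite !inE => /or3P[/eqP|/eqP|]; [by left|by right|].
  move=> /mapP[r rr sE]; have h1 := stay i c0 c0rs h 1; rewrite H1 /= sE in h1.
  by have := notF r (F r) rr h1; rewrite eqxx.
have six : s ix = iy.
  case: (snear ix nearx) => // sx.
  (* If [ix] were fixed, the square root of the direction of (z - c0)^2 Q(z) / Q(c0) would return to
     its value, whereas one turn of p - 1 about 0 multiplies it by [zeta R 2]. *)
  have := @winding_root_turn R 2 1 (- ofR (1 - b) / Q.[c0]) (@clamp R)
    (fun t => H ix t - c0) (fun t => Q.[H ix t] / Q.[c0]).
  rewrite H0 H1 /= sx => turn.
  have /turn : (0 < 2)%N by []. move=> {}turn.
  have : root_turn 2 1 (e ix - c0) (Q.[e ix] / Q.[c0]) =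
         zeta R 2 * root_turn 2 1 (e ix - c0) (Q.[e ix] / Q.[c0]).
    apply: turn.
    - rewrite mulf_neq0 ?invr_eq0 // oppr_eq0 -modulus_eq0 modulus_ofR normr_eq0.
      by rewrite subr_eq0 gt_eqF.
    - by apply: continuous_sub; [exact: cH | exact: continuous_const].
    - apply: continuous_div => [||t]; last exact: Qc.
        by apply: continuous_poly; exact: cH.
      exact: continuous_const.
    - by move=> t; apply: reQ; exact: stay.
    - exact: continuous_clamp.
    - exact: clamp0.
    - exact: clamp1.
    - move=> t; have : (p - 1).[H ix t] = - ofR (1 - b) * cis (pi *+ 2 * clamp t).
        rewrite hornerD hornerN -polyC1 hornerC HE /g; ring.
      rewrite E hornerM horner_exp hornerXsubC expr1 mulrA => ->.
      by rewrite mulrAC.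
  move=> /eqP; rewrite -[X in X == _]mul1r => /eqP /mulIf h.
  have /eqP : 1 = zeta R 2.
    apply: h; apply: root_turn_neq0; rewrite subr_eq0 eix (inj_eq (@ofR_inj R)).
    exact: npeak.
  have := prim_order_dvd (zeta_prim R (isT : (0 < 2)%N)) 1.
  by rewrite expr1 eq_sym => <-.
have siy : s iy = ix.
  case: (snear iy neary) => // sy.
  by have := six; rewrite -[RHS]sy => /(@perm_inj _ s) h; rewrite h eqxx in ixy.
exists ix, iy, x, y; split.
- have -> : tperm ix iy = s.
    apply/permP => i; case: tpermP => [->|->|/eqP nx /eqP ny]; rewrite ?six ?siy //.
    have := cover i; rewrite !inE (negPf nx) (negPf ny) /= => /mapP[r rr ->].
    by rewrite sfix.
  by apply/monodromyP; exists H.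
- by [].
- by rewrite xz andbT; move/andP: hx; lra.
- by rewrite zy /=; move/andP: hy; lra.
Qed.

End TranspositionAroundOne.

(** * Chinese remainders for moduli with a common factor; permutations as products of
    transpositions *)

Lemma common_residue m n a c : (0 < m)%N -> (0 < n)%N -> a = c %[mod gcdn m n] ->
  exists j, j = a %[mod m] /\ j = c %[mod n].
Proof.
move=> m0 n0 ac; have [km kn E _] := egcdnP n m0.
(* Adding a * n, which is 0 modulo n, keeps the difference from a within the naturals. *)
have ca : a <= c + a * n by rewrite (leq_trans (leq_pmulr a n0)) ?leq_addl.
have /dvdnP[q qE] : gcdn m n %| c + a * n - a.
  rewrite -eqn_mod_dvd // -modnDmr.
  have /eqP -> : (a * n == 0 %[mod gcdn m n])%N.
    by rewrite mod0n; apply/eqP/eqP; rewrite -/(dvdn _ _) dvdn_mull // dvdn_gcdr.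
  by rewrite mod0n addn0 eq_sym; apply/eqP.
exists (a + q * km * m); split; first by rewrite addnC modnMDl.
have -> : a + q * km * m = c + (a + q * kn) * n.
  by rewrite -mulnA E mulnDr -qE addnCA subnKC // addnCA mulnDl mulnA (addnC (a * n)).
by rewrite addnC modnMDl.
Qed.

(** Induction on the number of moved points: following s by the transposition of i and s i, which
    have the same color, fixes i and moves no new point. *)
Lemma perm_of_tperms (T : finType) (C : eqType) (c : T -> C) (P : {perm T} -> Prop) :
    P 1%g -> (forall s u, P s -> P u -> P (s * u)%g) ->
    (forall u v, u != v -> c u = c v -> P (tperm u v)) ->
  forall s : {perm T}, (forall i, c (s i) = c i) -> P s.
Proof.
move=> P1 PM Pt s.
elim: {s}_.+1 {-2}s (ltnSn #|[set i | s i != i]%SET|) => // N IH s sN cs.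
have [i si|s1] := pickP (fun i => s i != i); last first.
  rewrite (_ : s = 1%g) //; apply/permP => i; rewrite perm1.
  by apply/eqP; have /negbFE := s1 i.
have -> : s = ((s * tperm i (s i)) * tperm i (s i))%g by rewrite -mulgA tperm2 mulg1.
have ct j : c (tperm i (s i) j) = c j by case: tpermP => [->|->|]; rewrite ?cs.
apply: PM; last by apply: Pt; rewrite ?cs 1?eq_sym.
apply: IH => [|j]; last by rewrite permM ct cs.
rewrite -ltnS; apply: leq_trans sN; rewrite ltnS; apply: proper_card.
apply/properP; split; last by exists i; rewrite !inE ?si // permM tpermR eqxx.
apply/fintype.subsetP => j; rewrite !inE permM; apply: contra => /eqP sj.
rewrite sj tpermD //; first by apply: contraNneq si => ->; rewrite sj.
by apply: contraNneq si => h; move: sj; rewrite -h => /perm_inj ->.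
Qed.

(** * The monodromy group on the fibre, over a real base point and then over any *)

Section MonodromyGroup.
Variable R : realType.
Local Open Scope ring_scope.
Variables (m n : nat).
Hypotheses (m0 : (0 < m)%N) (n0 : (0 < n)%N).
Local Notation p := (Pmn R m n).
Local Notation z0 := (peak R m n).
Local Notation k := (gcdn m n).
Implicit Types (e : 'I_(m + n) -> CC R).

Let d0 : (0 < m + n)%N. Proof. by rewrite addn_gt0 m0. Qed.
Let k0 : (0 < k)%N. Proof. by rewrite gcdn_gt0 m0. Qed.

Definition root_Pmn : {poly CC R} := 'X^(m %/ k) * (1 - 'X) ^+ (n %/ k).

Lemma root_PmnX : root_Pmn ^+ k = (ofR (scale_factor R m n))^-1 *: p.
Proof.
rewrite /Pmn -ofR_scale_factor scalerA mulVf ?scale_factorC_neq0 // scale1r.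
by rewrite exprMn -!exprM !divnK ?dvdn_gcdl ?dvdn_gcdr.
Qed.

Let f := root_Pmn.
Local Notation c0 := ((ofR (scale_factor R m n))^-1).

Let c0_neq0 : c0 != 0. Proof. by rewrite invr_eq0 scale_factorC_neq0. Qed.

Lemma root_Pmn_neq0 z : p.[z] != 0 -> f.[z] != 0.
Proof.
apply: contra => /eqP fz; have := congr1 (horner^~ z) root_PmnX.
rewrite horner_exp hornerZ -/f fz expr0n gtn_eqF //= => /esym/eqP.
by rewrite mulf_eq0 (negPf c0_neq0).
Qed.

Lemma root_Pmn_real x : f.[ofR x] = ofR (x ^+ (m %/ k) * (1 - x) ^+ (n %/ k)).
Proof.
rewrite /f /root_Pmn hornerM !horner_exp hornerX hornerD hornerN hornerX -polyC1 hornerC.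
by rewrite rmorphM !rmorphXn /= rmorphB rmorph1.
Qed.

Lemma root_Pmn_real_inj x y : 0 < x < 1 -> 0 < y < 1 ->
  p.[ofR x] = p.[ofR y] -> f.[ofR x] = f.[ofR y].
Proof.
have pos w : 0 < w < 1 -> 0 <= w ^+ (m %/ k) * (1 - w) ^+ (n %/ k).
  by move=> /andP[w0 w1]; rewrite mulr_ge0 ?exprn_ge0 ?subr_ge0 // ltW.
move=> /pos hx /pos hy pxy; rewrite !root_Pmn_real; congr ofR; apply/eqP.
rewrite -(@eqrXn2 _ k) //; apply/eqP/(@ofR_inj R).
rewrite !rmorphXn /= -!root_Pmn_real -!horner_exp root_PmnX.
by rewrite !(hornerZ _ p) pxy.
Qed.

(** The cross-multiplied equation says that s multiplies f by one factor on the whole fibre. *)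
Definition good_base (b : R) := 0 < b < 1 /\
  forall e, numbering p (ofR b) e -> forall s : 'S_(m + n),
  (forall i j, f.[e (s i)] * f.[e j] = f.[e (s j)] * f.[e i]) ->
  s \in monodromy p e.

(** Generation by the transposition around 1 and the rotation r around 0. The orbits L and K of the
    exchanged points are the fibre points to the left and to the right of the peak, and f is
    multiplied by [zeta R k] at each step. *)
Lemma good_base_exists : exists b, good_base b.
Proof.
have [b0 /andP[b00 b01] tau] := transposition_around_one R m0 n0.
have bb : b0 < (b0 + 1) / 2 < 1 by apply/andP; split; lra.
exists ((b0 + 1) / 2); set b := (b0 + 1) / 2 in bb *.
have b_itv : 0 < b < 1 by lra.
have /andP[bp b1] := b_itv.
split=> // e ne s hs; have [ei pe] := ne.
have pE i : p.[e i] = ofR b by apply/pe; exists i.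
have bC0 : ofR b != 0.
  by rewrite -(rmorph0 (@ofR R)) (inj_eq (@ofR_inj R)) gt_eqF.
have bC1 : ofR b != 1.
  by rewrite -(rmorph1 (@ofR R)) (inj_eq (@ofR_inj R)) lt_eqF.
have fe i : f.[e i] != 0 by apply: root_Pmn_neq0; rewrite pE.
have [ix [iy [x [y [tM [ex ey] /andP[x0 xz] /andP[zy y1]]]]]] := tau b e bb ne.
have [r rM [rside rleft rright rf]] := rotation_around_zero m0 n0 b_itv ne.
have npk := side_of_peak m0 n0 b_itv ne.
pose M := monodromy p e.
have M1 : 1%g \in M by apply: monodromy1 bC0 bC1.
have rXM j : (r ^+ j)%g \in M.
  by elim: j => [|j IH]; rewrite ?expg0 // expgS; exact: monodromyM.
have fxy : f.[e ix] = f.[e iy].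
  have /andP[pk0 pk1] := peak_itv R m0 n0.
  have hx : 0 < x < 1 by lra.
  have hy : 0 < y < 1 by lra.
  by rewrite ex ey; apply: root_Pmn_real_inj hx hy _; rewrite -ex -ey !pE.
pose L j := (r ^+ j)%g ix; pose K j := (r ^+ j)%g iy.
have LS j : L j.+1 = r (L j) by rewrite /L expgSr permM.
have KS j : K j.+1 = r (K j) by rewrite /K expgSr permM.
have fr i : f.[e (r i)] = zeta R k * f.[e i] by apply: rf k0 root_PmnX i.
have frX j i : f.[e ((r ^+ j)%g i)] = zeta R k ^+ j * f.[e i].
  elim: j => [|j IH]; first by rewrite expg0 perm1 mul1r.
  by rewrite expgSr permM fr IH exprS mulrA.
have Lside j : re (e (L j)) < z0.
  by elim: j => [|j IH]; [rewrite /L expg0 perm1 ex re_ofR | rewrite LS rside].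
have Kside j : z0 < re (e (K j)).
  rewrite lt_neqAle eq_sym npk /= leNgt; apply/negP.
  elim: j => [|j IH]; last by rewrite KS rside.
  by rewrite /K expg0 perm1 ey re_ofR => /(lt_trans zy); rewrite ltxx.
pose U i := root_turn m n (e i) (1 - e i).
pose V i := root_turn n m (1 - e i) (e i).
have UL j : U (L j) = zeta R m ^+ j * U ix.
  elim: j => [|j IH]; first by rewrite /L expg0 perm1 mul1r.
  by rewrite LS /U rleft // -/(U _) IH exprS mulrA.
have VK j : V (K j) = zeta R n ^+ j * V iy.
  elim: j => [|j IH]; first by rewrite /K expg0 perm1 mul1r.
  by rewrite KS /V rright // -/(V _) IH exprS mulrA.
have nz i : e i != 0 /\ 1 - e i != 0.
  have := pE i; rewrite horner_Pmn => h; split; apply/eqP => ei0;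
  by move: h; rewrite ei0 expr0n gtn_eqF //= ?(mul0r, mulr0) => /esym/eqP; apply/negP.
have U0 i : U i != 0 by apply: root_turn_neq0; have [] := nz i.
have V0 i : V i != 0 by apply: root_turn_neq0; have [] := nz i.
have zm := zeta_prim R m0; have zn := zeta_prim R n0.
have Leq i j : L i = L j -> i = j %[mod m].
  by move=> /(congr1 U); rewrite !UL => /(mulIf (U0 ix)) /eqP;
     rewrite (eq_prim_root_expr zm) => /eqP.
have Keq i j : K i = K j -> i = j %[mod n].
  by move=> /(congr1 V); rewrite !VK => /(mulIf (V0 iy)) /eqP;
     rewrite (eq_prim_root_expr zn) => /eqP.
have LK i j : L i != K j.
  by apply/eqP => h; have := lt_trans (Lside i) (Kside j); rewrite h ltxx.
(* The [root_turn] invariants separate the first m points L j and the first n points K j, and the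
   sides separate L from K: m + n distinct points are the whole fibre. *)
have cover u : (exists2 j, (j < m)%N & u = L j) \/ (exists2 j, (j < n)%N & u = K j).
  pose h (a : 'I_(m + n)) := match fintype.split a with inl i => L i | inr j => K j end.
  have hi : injective h.
    move=> a a'; rewrite -[a]splitK -[a']splitK /h !unsplitK.
    case: (fintype.split a) => i; case: (fintype.split a') => j /=.
    - by move=> /Leq; rewrite !modn_small // => /val_inj ->.
    - by move=> hij; have := LK i j; rewrite hij eqxx.
    - by move=> hij; have := LK j i; rewrite hij eqxx.
    - by move=> /Keq; rewrite !modn_small // => /val_inj ->.
  have /codomP[a ->] := injF_onto hi u.
  rewrite /h; case: (fintype.split a) => j; [left | right]; by exists j.
have L0 : L 0 = ix by rewrite /L expg0 perm1.
have Lmod i j : i = j %[mod m] -> L i = L j.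
  move=> ij; case: (cover (L i)) => -[c cm ic]; last by have := LK i c; rewrite ic eqxx.
  case: (cover (L j)) => -[c' cm' jc]; last by have := LK j c'; rewrite jc eqxx.
  rewrite ic jc; congr L; have := Leq _ _ ic; have := Leq _ _ jc.
  by rewrite ij => ->; rewrite !modn_small.
have Kmod i j : i = j %[mod n] -> K i = K j.
  move=> ij; case: (cover (K i)) => -[c cm ic]; first by have := LK c i; rewrite ic eqxx.
  case: (cover (K j)) => -[c' cm' jc]; first by have := LK c' j; rewrite jc eqxx.
  rewrite ic jc; congr K; have := Keq _ _ ic; have := Keq _ _ jc.
  by rewrite ij => ->; rewrite !modn_small.
have fL j : f.[e (L j)] = zeta R k ^+ j * f.[e ix] by exact: frX.
have fK j : f.[e (K j)] = zeta R k ^+ j * f.[e ix] by rewrite fxy; exact: frX.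
have tX j : tperm (L j) (K j) \in M.
  rewrite -tpermJ /conjg; apply: monodromyM; first exact/monodromyV/rXM.
  by apply: monodromyM; [exact: tM | exact: rXM].
have zk := zeta_prim R k0.
have modk i j : zeta R k ^+ i * f.[e ix] = zeta R k ^+ j * f.[e ix] -> i = j %[mod k].
  by move=> /(mulIf (fe ix)) /eqP; rewrite (eq_prim_root_expr zk) => /eqP.
(* Equal values of f mean i = j mod k, so a single power of r reaches both L i and K j. *)
have tLK i j : f.[e (L i)] = f.[e (K j)] -> tperm (L i) (K j) \in M.
  rewrite fL fK => /modk ij; have [c [ci cj]] := common_residue m0 n0 ij.
  by rewrite -(Lmod c i ci) -(Kmod c j cj); exact: tX.
have tconj u v w : u != v -> u != w -> v != w ->
    tperm u w \in M -> tperm v w \in M -> tperm u v \in M.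
  move=> uv uw vw hu hv.
  have -> : tperm u v = (tperm u w ^ tperm v w)%g.
    by rewrite tpermJ tpermR tpermD // eq_sym.
  by rewrite /conjg tpermV; apply: monodromyM => //; exact: monodromyM.
(* Two points on the same side are joined through the point with index a on the other side, where f
   takes the same value. *)
have tuv u v : u != v -> f.[e u] = f.[e v] -> tperm u v \in M.
  move=> uv fuv; case: (cover u) => -[a am ua]; case: (cover v) => -[c cm vc].
  - have wv : tperm v (K a) \in M by rewrite vc; apply: tLK; rewrite -vc -fuv ua fL fK.
    have wu : tperm u (K a) \in M by rewrite ua; apply: tLK; rewrite fL fK.
    by apply: tconj wu wv; rewrite ?ua ?vc ?LK // -ua -vc.
  - by rewrite ua vc; apply: tLK; rewrite -ua -vc.
  - by rewrite ua vc tpermC; apply: tLK; rewrite -ua -vc.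
  - have wv : tperm v (L a) \in M.
      by rewrite vc tpermC; apply: tLK; rewrite -vc -fuv ua fL fK.
    have wu : tperm u (L a) \in M by rewrite ua tpermC; apply: tLK; rewrite fL fK.
    by apply: tconj wu wv; rewrite ?ua ?vc 1?[_ == L a]eq_sym ?LK // -ua -vc.
have [j sj] : exists j, f.[e (s ix)] = zeta R k ^+ j * f.[e ix].
  by case: (cover (s ix)) => -[j _ ->]; exists j.
have fs i : f.[e (s i)] = zeta R k ^+ j * f.[e i].
  by apply: (mulIf (fe ix)); rewrite hs sj mulrAC.
have zj : zeta R k ^+ j != 0 by rewrite expf_neq0 // cis_neq0.
(* Undoing the common factor by a power of r leaves a permutation that preserves f. *)
suff : (s * (r ^+ j)^-1)%g \in M.
  move=> h; rewrite -[s](mulgKV (r ^+ j)%g); exact: monodromyM.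
apply: (perm_of_tperms M1 (fun a c => @monodromyM _ _ _ e a c) tuv) => i.
apply: (mulfI zj); rewrite permM -frX permKV; exact: fs.
Qed.

Lemma moves_segment w w' e :
    (forall t, 0 <= t <= 1 ->
      w + ofR t * (w' - w) != 0 /\ w + ofR t * (w' - w) != 1) ->
    numbering p w e ->
  exists2 e', numbering p w' e' & moves p e e'.
Proof.
move=> hw ne; pose g t : CC R := w + ofR (clamp t) * (w' - w).
have cg : continuous g.
  apply: continuous_add; first exact: continuous_const.
  apply: continuous_mul; last exact: continuous_const.
  by apply: continuous_ofR; exact: continuous_clamp.
have ng t : g t != 0 /\ g t != 1 by apply: hw; exact: clamp_itv.
have g00 : g 0 = w by rewrite /g clamp0 rmorph0 mul0r addr0.
have g11 : g 1 = w' by rewrite /g clamp1 rmorph1 mul1r addrC subrK.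
have ne' : numbering p (g 0) e by rewrite g00.
have [H [e' [mH _ ne1]]] :=
  path_motion (size_Pmn R m0 n0) d0 (@critical_values R m n m0 n0) cg ng ne'.
by exists e'; [rewrite -g11 | exists H].
Qed.

Lemma moves_to_real w b e : w != 0 -> w != 1 -> 0 < b < 1 -> numbering p w e ->
  exists2 e', numbering p (ofR b) e' & moves p e e'.
Proof.
move=> w0 w1 /andP[b0 b1] ne.
have im_neq z : im z != 0 -> z != 0 /\ z != 1.
  by move=> hz; split; apply: contraNneq hz => ->; rewrite ?im0 ?im1.
(* The path goes from w straight to the point h on the imaginary axis, then straight to b. With h on
   the side of w, it meets the real axis at most at its ends w and b, so it avoids 0 and 1. *)
have [h [hn hw]] : exists h : R, h != 0 /\ 0 <= im w * h.
  case: (lerP 0 (im w)) => hw; first by exists 1; rewrite mulr1 oner_eq0.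
  by exists (-1); rewrite oppr_eq0 oner_eq0 mulrN1 oppr_ge0 ltW.
have h2 : 0 < h * h by rewrite -expr2 exprn_even_gt0.
have [e1 ne1 m1] : exists2 e', numbering p (cplx 0 h) e' & moves p e e'.
  apply: moves_segment ne => t /andP[t0 t1].
  have [->|tn] := eqVneq t 0; first by rewrite rmorph0 mul0r addr0.
  have tpos : 0 < t by rewrite lt_neqAle eq_sym tn.
  apply: im_neq; rewrite imD imM re_ofR im_ofR mul0r addr0 imB im_cplx.
  apply/eqP => /(congr1 (fun u => u * h)); rewrite mul0r.
  have : 0 < t * (h * h) by rewrite mulr_gt0.
  have : 0 <= (1 - t) * (im w * h) by rewrite mulr_ge0 // subr_ge0.
  lra.
have [e2 ne2 m2] : exists2 e', numbering p (ofR b) e' & moves p e1 e'.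
  apply: moves_segment ne1 => t /andP[t0 t1].
  have [->|tn] := eqVneq t 1.
    rewrite rmorph1 mul1r addrC subrK -(rmorph0 (@ofR R)) -(rmorph1 (@ofR R)).
    by rewrite !(inj_eq (@ofR_inj R)) (gt_eqF b0) (lt_eqF b1).
  apply: im_neq; rewrite imD imM re_ofR im_ofR mul0r addr0 imB im_cplx im_ofR.
  have -> : h + t * (0 - h) = (1 - t) * h by ring.
  by rewrite mulf_neq0 // subr_eq0 eq_sym.
by exists e2 => //; exact: moves_trans m1 m2.
Qed.

(** For the converse, e is moved to a fibre e' over a good base. That motion multiplies f by one
    common factor, so the condition on s carries over to e', and the conclusion is transported
    back. *)
Theorem monodromyE w e : w != 0 -> w != 1 -> numbering p w e ->
  forall s : 'S_(m + n),
  s \in monodromy p e <->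
  (forall i j, f.[e (s i)] * f.[e j] = f.[e (s j)] * f.[e i]).
Proof.
move=> w0 w1 ne s; split=> [/monodromyP es i j|hs].
  exact: moves_power_ratio k0 c0_neq0 root_PmnX es i j.
have [b [bi gb]] := good_base_exists.
have [e' ne' ee'] := moves_to_real w0 w1 bi ne.
apply: monodromy_transport (moves_sym ee') _; apply: gb => // i j.
have fe i' : f.[e i'] != 0.
  by apply: root_Pmn_neq0; rewrite (_ : p.[e i'] = w) //; apply/ne.2; exists i'.
have fe' := moves_power_ratio k0 c0_neq0 root_PmnX ee'.
apply: (mulIf (fe i)); apply: (mulIf (fe i)).
have h1 u : f.[e' u] * f.[e i] = f.[e' i] * f.[e u] by exact: fe'.
rewrite [LHS](_ : _ = (f.[e' (s i)] * f.[e i]) * (f.[e' j] * f.[e i])); last by ring.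
rewrite [RHS](_ : _ = (f.[e' (s j)] * f.[e i]) * (f.[e' i] * f.[e i])); last by ring.
rewrite !h1 [LHS](_ : _ = f.[e' i] * f.[e' i] * (f.[e (s i)] * f.[e j])); last by ring.
by rewrite hs; ring.
Qed.

End MonodromyGroup.

(** * From the Riemann sphere to the plane *)

Section Sphere.
Variable R : realType.
Local Open Scope classical_set_scope.
Local Open Scope ring_scope.
Variables (m n : nat).
Hypotheses (m0 : (0 < m)%N) (n0 : (0 < n)%N).
Local Notation p := (Pmn R m n).
Local Notation P := (poly_P1 p).

Let d0 : (0 < m + n)%N. Proof. by rewrite addn_gt0 m0. Qed.

(** The value 0 at infinity is a default; the paths in question avoid infinity. *)
Definition finite_part (z : P1 R) : CC R := if z is Some x then x else 0.

Lemma finite_partK z : z <> None -> Some (finite_part z) = z.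
Proof. by case: z. Qed.

Lemma continuous_finite_part (T : topologicalType) (h : T -> P1 R) :
  continuous h -> (forall t, h t <> None) -> continuous (fun t => finite_part (h t)).
Proof.
move=> ch hN t U /= Ut.
have : nbhs (h t) (Some @` U).
  rewrite -(finite_partK (hN t)).
  exact: (@one_point_compactification_some_nbhs (CC R) (finite_part (h t)) U Ut).
move=> /(ch t) hU; rewrite nbhs_simpl.
apply: (@filterS _ (nbhs t) _ _ _ _ hU) => s /= [x Ux xs].
by rewrite -xs.
Qed.

Lemma continuous_clamped (h : R -> P1 R) :
  {within `[0, 1], continuous h} -> continuous (fun t => h (clamp t)).
Proof.
move=> /subspace_continuousP ch t U hU.
have ct : `[0, 1]%classic (clamp t) by rewrite /= in_itv; exact: clamp_itv.
have := ch _ ct U hU; rewrite /= => /(@continuous_clamp R t) hU'.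
apply: (@filterS _ (nbhs t) _ _ _ _ hU') => s /=; apply.
by rewrite /= in_itv; exact: clamp_itv.
Qed.

Lemma avoids_P1 (z : P1 R) : ~ zero_one_infty z ->
  exists w, [/\ z = Some w, w != 0 & w != 1].
Proof.
case: z => [w|] h; last by case: h; right.
by exists w; split=> //; apply/eqP => wE; apply: h; left; [left | right]; rewrite wE.
Qed.

Lemma fibre_exists (w : CC R) : w != 0 -> w != 1 ->
  exists e : 'I_(m + n) -> P1 R, fibre_numbering P (Some w) e.
Proof.
move=> w0 w1; have [|c [ci cp]] := @numbering_exists R p _ (size_Pmn R m0 n0) d0 w.
  move=> z pz; apply/eqP => /(critical_values m0 n0); rewrite pz => -[] h.
    by rewrite h eqxx in w0.
  by rewrite h eqxx in w1.
exists (fun i => Some (c i)); split.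
- by move=> i _ /=; rewrite /poly_P1; congr Some; apply/cp; exists i.
- by move=> i j _ _ [/ci].
- move=> [z|//] [/cp [i <-]]; by exists i.
Qed.

Lemma fibre_numberingP (w : CC R) (e : 'I_(m + n) -> P1 R) :
  fibre_numbering P (Some w) e ->
  (forall i, e i = Some (finite_part (e i))) /\
  numbering p w (fun i => finite_part (e i)).
Proof.
move=> [ef ei es].
have eS i : e i = Some (finite_part (e i)).
  by have := ef i I; rewrite /=; case: (e i).
have pe i : p.[finite_part (e i)] = w.
  by have := ef i I; rewrite /= eS => -[].
split=> //; apply: (numbering_inj (size_Pmn R m0 n0) d0) => // i j eij.
by apply: ei; rewrite ?in_setE // eS eij -eS.
Qed.

(** A polynomial sends infinity to infinity, so lifts of a loop that avoids infinity are finite;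
    clamping makes them global paths in the plane. Conversely, any one lift of a motion recovers the
    loop as its image under p. *)
Lemma Mon_monodromy (w : CC R) (e : 'I_(m + n) -> P1 R) : w != 0 -> w != 1 ->
  fibre_numbering P (Some w) e ->
  Mon R P (@zero_one_infty R) (Some w) e = monodromy p (fun i => finite_part (e i)).
Proof.
move=> w0 w1 /fibre_numberingP [eS [ci cp]].
have pe i : p.[finite_part (e i)] = w by apply/cp; exists i.
apply/setP => s; rewrite !inE; apply/asboolP/asboolP.
  move=> [g [cg gB g0 g1] lifts].
  have hE i : {h : R -> P1 R | lift_of P g h & h 0 = e i /\ h 1 = e (s i)}.
    apply: cid2; have [h lh h01] := lifts i; by exists h.
  pose h i := s2val (hE i).
  have hl i : lift_of P g (h i) := s2valP (hE i).
  have h01 i : h i 0 = e i /\ h i 1 = e (s i) := s2valP' (hE i).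
  have hg i t : P (h i (clamp t)) = g (clamp t).
    by have [_] := hl i; apply; rewrite in_itv; exact: clamp_itv.
  have gN t : ~ zero_one_infty (g (clamp t)).
    by apply: gB; rewrite in_itv; exact: clamp_itv.
  have hN i t : h i (clamp t) <> None.
    by move=> hn; apply: (gN t); rewrite -(hg i) hn /=; right.
  have pH i t : Some p.[finite_part (h i (clamp t))] = g (clamp t).
    by rewrite -(hg i) -{2}(finite_partK (hN i t)).
  exists (fun i t => finite_part (h i (clamp t))); split.
  - move=> i; apply: continuous_finite_part; last exact: hN.
    by apply: continuous_clamped; have [] := hl i.
  - by move=> i j t; have := pH i t; rewrite -(pH j t) => -[].
  - move=> i t; have [v [gv v0 v1]] := avoids_P1 (gN t).
    by have := pH i t; rewrite gv => -[->].
  - by move=> i; rewrite clamp0 (h01 i).1.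
  - by move=> i; rewrite clamp1 (h01 i).2.
move=> [H [cH pH nH H0 H1]].
have i0 : 'I_(m + n) := Ordinal d0.
have cS (F : R -> CC R) : continuous F ->
    {within `[0, 1], continuous (fun t => Some (F t) : P1 R)}.
  move=> cF; apply: (@continuous_subspaceT R (one_point_compactification (CC R))).
  move=> t; apply: (continuous_comp (cF t)).
  exact: one_point_compactification_some_continuous.
exists (fun t => Some p.[H i0 t]).
  split.
  - by apply: cS; apply: continuous_poly; exact: cH.
  - move=> u _ [[]|] // [] /eqP; apply/negP; first exact: (nH i0 u).1.
    exact: (nH i0 u).2.
  - by rewrite H0 pe.
  - by rewrite H1 /= pe.
move=> i; exists (fun t => Some (H i t)).
  split; first by apply: cS; exact: cH.
  by move=> u _; rewrite /poly_P1 (pH i i0).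
by rewrite H0 H1 /= -!eS.
Qed.

End Sphere.

(** * Wreath products with a cyclic group *)

Section WreathProducts.
Local Open Scope group_scope.

Lemma rotationX k (y : 'I_k) j : ((rotation k ^+ j) y = (y + j) %% k :> nat)%N.
Proof.
elim: j => [|j IH]; first by rewrite expg0 perm1 addn0 modn_small.
by rewrite expgSr permM permE /= IH -addn1 modnDml addn1 addnS.
Qed.

Lemma order_rotation k : (0 < k)%N -> #[rotation k] = k.
Proof.
move=> k0; apply/eqP; rewrite eqn_dvd; apply/andP; split.
  rewrite order_dvdn; apply/eqP/permP => y; apply: val_inj.
  by rewrite /= rotationX perm1 modnDr modn_small.
have := rotationX (Ordinal k0) #[rotation k].
by rewrite expg_order perm1 /= add0n => /esym/eqP.
Qed.

Lemma wreath_fun_inj a b (F : {ffun 'I_b -> 'S_a}) (c : 'S_b) :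
  injective (fun x : 'I_a * 'I_b => (F x.2 x.1, c x.2)).
Proof. by move=> [x y] [x' y'] /= [+ /perm_inj yy']; rewrite yy' => /perm_inj ->. Qed.

Definition wreath_perm a b (x : {ffun 'I_b -> 'S_a} * 'S_b) : {perm 'I_a * 'I_b} :=
  perm (@wreath_fun_inj a b x.1 x.2).

Lemma wreath_permP a b (C : {set 'S_b}) (s : {perm 'I_a * 'I_b}) :
  reflect (exists (F : {ffun 'I_b -> 'S_a}) (c : 'S_b), c \in C /\
           forall x, s x = (F x.2 x.1, c x.2))
          (s \in wreath a C).
Proof.
rewrite inE; apply: (iffP exists_inP) => [[c cC /existsP[F /forallP h]]|[F [c [cC h]]]].
  by exists F, c; split=> // x; apply/eqP.
by exists c => //; apply/existsP; exists F; apply/forallP => x; rewrite h.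
Qed.

Lemma card_wreath a b (C : {set 'S_b}) : (0 < a)%N ->
  #|wreath a C| = (a`! ^ b * #|C|)%N.
Proof.
move=> a0.
have -> : wreath a C = @wreath_perm a b @: finset.setX [set: {ffun 'I_b -> 'S_a}]%SET C.
  apply/setP => s; apply/wreath_permP/imsetP => [[F [c [cC h]]]|[[F c]]].
    exists (F, c); first by rewrite !inE.
    by apply/permP => x; rewrite permE h.
  by rewrite !inE /= => cC ->; exists F, c; split=> // x; rewrite permE.
rewrite card_imset; last first.
  move=> [F c] [F' c'] /permP h.
  have {}h x : (F x.2 x.1, c x.2) = (F' x.2 x.1, c' x.2).
    by have := h x; rewrite !permE.
  congr (_, _).
    by apply/ffunP => y; apply/permP => x; have [] := h (x, y).
  by apply/permP => y; have [] := h (Ordinal a0, y).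
by rewrite cardsX cardsT card_ffun card_Sn card_ord.
Qed.

Lemma perm_isomorphic_card (S T : finType) (G : {set {perm S}}) (H : {set {perm T}}) :
  perm_isomorphic G H -> #|G| = #|H|.
Proof.
move=> [f [g fK gK] GH].
have fsgi (s : {perm S}) : injective (fun x => f (s (g x))).
  by move=> x y /(can_inj fK) /perm_inj /(can_inj gK).
have gsfi (u : {perm T}) : injective (fun x => g (u (f x))).
  by move=> x y /(can_inj gK) /perm_inj /(can_inj fK).
pose Phi s := perm (fsgi s).
have PhiE (s : {perm S}) x : f (s x) = Phi s (f x) by rewrite permE fK.
rewrite -(card_imset (mem G) (f := Phi)) => [|s s' /permP h]; last first.
  by apply/permP => x; apply: (can_inj fK); rewrite !PhiE h.
apply: eq_card => u; apply/imsetP/idP => [[s sG ->]|uH].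
  by rewrite -(GH s) // => x; exact: PhiE.
have uE : u = Phi (perm (gsfi u)).
  by apply/permP => x; rewrite !permE !gK.
exists (perm (gsfi u)) => //; rewrite (GH _ u) // => x.
by rewrite permE gK.
Qed.

(** * Groups of all permutations that rotate a balanced coloring *)

Section Coloring.
Variables (d a k : nat) (color : 'I_d -> 'I_k) (G : {set 'S_d}).
Hypotheses (k0 : (0 < k)%N) (a1 : (1 < a)%N).
Hypothesis card_class : forall y, #|[set i | color i == y]%SET| = a.
Hypothesis GP : forall s : 'S_d,
  s \in G <-> exists j, forall i, color (s i) = (rotation k ^+ j) (color i).

Let class y := [set i | color i == y]%SET.

Let a0 : (0 < a)%N. Proof. exact: ltnW. Qed.

Lemma card_colored : d = (a * k)%N.
Proof.
have := card_ord d; rewrite -sum1_card (partition_big color xpredT) //= => <-.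
rewrite (eq_bigr (fun=> a)) => [|y _]; first by rewrite sum_nat_const card_ord mulnC.
by rewrite -(card_class y) -sum1dep_card.
Qed.

Lemma class_exists y : exists i, color i = y.
Proof.
have : (0 < #|class y|)%N by rewrite card_class.
by case/card_gt0P => i; rewrite inE => /eqP; exists i.
Qed.

(** The first coordinate is the rank of a letter within its color class. *)
Lemma letters_bijection :
  exists2 f : 'I_d -> 'I_a * 'I_k, bijective f & forall i, (f i).2 = color i.
Proof.
have h i : (index i (enum (class (color i))) < a)%N.
  by rewrite -(card_class (color i)) cardE index_mem mem_enum inE.
exists (fun i => (Ordinal (h i), color i)) => //.
apply: inj_card_bij; last by rewrite card_prod !card_ord -card_colored.
move=> i j [ij cij]; rewrite cij in ij.
have mem x : color x = color j -> x \in enum (class (color j)).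
  by move=> cx; rewrite mem_enum inE cx.
by rewrite -(nth_index i (mem i cij)) ij nth_index // mem.
Qed.

Lemma colored_wreath : perm_isomorphic G (wreath_cyclic a k).
Proof.
have [f fb f2] := letters_bijection; exists f => // s u su.
have [g fK gK] := fb.
apply/idP/wreath_permP.
  move=> /GP [j hj].
  have u2 x : (u x).2 = (rotation k ^+ j) x.2 by rewrite -(gK x) -su !f2 hj.
  have inj y : injective (fun x => (u (x, y)).1).
    move=> x x' xx'; suff /perm_inj [] : u (x, y) = u (x', y) by [].
    by rewrite [LHS]surjective_pairing [RHS]surjective_pairing xx' !u2.
  exists [ffun y => perm (inj y)], (rotation k ^+ j); split; first exact: mem_cycle.
  by move=> [x y]; rewrite ffunE permE /= [LHS]surjective_pairing u2.
move=> [F [c [/cycleP[j ->] h]]]; apply/GP; exists j => i.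
by rewrite -!f2 su h.
Qed.

Lemma colored_blocks : exists Q : {set {set 'I_d}},
  [/\ block_system G Q, #|Q| = k & forall A : {set 'I_d}, A \in Q -> #|A| = a].
Proof.
exists (class @: [set: 'I_k]%SET)%SET; split.
- apply/andP; split; last first.
    apply/fintype.subsetP => s /GP [j hj]; rewrite !inE /=.
    apply/fintype.subsetP => A /imsetP[y _ ->]; rewrite inE.
    apply/imsetP; exists ((rotation k ^+ j) y); first by rewrite inE.
    apply/setP => i; apply/imsetP/idP => [[x]|].
      by rewrite inE => /eqP xy ->; rewrite inE /= /aperm hj xy.
    rewrite inE => /eqP iy; exists (s^-1 i); last by rewrite /= /aperm permKV.
    rewrite inE; apply/eqP/(@perm_inj _ (rotation k ^+ j)).
    by rewrite -hj permKV.
  apply/and3P; split.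
  + apply/eqP/setP => i; rewrite inE; apply/bigcupP; exists (class (color i)).
      exact: imset_f.
    by rewrite inE.
  + apply/finset.trivIsetP => A B /imsetP[y _ ->] /imsetP[y' _ ->] yy'.
    rewrite -setI_eq0; apply/eqP/setP => i; rewrite !inE.
    by apply/andP => -[/eqP iy /eqP iy']; rewrite -iy -iy' eqxx in yy'.
  + apply/imsetP => -[y _ y0]; have := card_class y.
    by rewrite -/(class y) -y0 cards0 => aE; move: a0; rewrite -aE.
- rewrite card_imset ?cardsT ?card_ord // => y y' /setP yy'.
  have [i iy] := class_exists y; have := yy' i.
  by rewrite !inE iy eqxx => /esym/eqP.
- by move=> A /imsetP[y _ ->]; exact: card_class.
Qed.

Lemma colored_full : G = [set: 'S_d]%SET <-> k = 1%N.
Proof.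
split=> [GT|k1]; last first.
  apply/setP => s; rewrite inE; apply/GP; exists 0%N => i.
  have ord0E (y : 'I_k) : y = 0%N :> nat.
    by have := ltn_ord y; rewrite [X in (_ < X)%N]k1; case: (y : nat).
  by apply: val_inj; rewrite /= !ord0E.
apply/eqP; rewrite eqn_leq k0 andbT leqNgt; apply/negP => k1.
(* For k > 1, take i and i' of color 0 and j of color 1. The transposition of i' and j fixes i, so
   its rotation would fix color 0, yet it takes i' to color 1. *)
pose y0 := Ordinal k0; pose y1 := Ordinal k1.
have : (1 < #|class y0|)%N by rewrite card_class.
move=> /card_gt1P[i [i' [+ + ii']]]; rewrite !inE => /eqP iy /eqP iy'.
have [j jy] := class_exists y1.
have : tperm i' j \in G by rewrite GT inE.
move=> /GP [N hN]; have := hN i; have := hN i'; rewrite tpermL tpermD; last 2 first.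
- by rewrite eq_sym.
- by apply/eqP => ji; move: jy; rewrite ji iy.
by rewrite iy iy' jy => <-.
Qed.

End Coloring.

End WreathProducts.

(** * The coloring of the fibre by the values of f *)

Section ColoringOfFibre.
Variable R : realType.
Local Open Scope ring_scope.
Variables (m n : nat).
Hypotheses (m0 : (0 < m)%N) (n0 : (0 < n)%N).
Local Notation p := (Pmn R m n).
Local Notation k := (gcdn m n).
Local Notation f := (root_Pmn R m n).

Let d0 : (0 < m + n)%N. Proof. by rewrite addn_gt0 m0. Qed.
Let k0 : (0 < k)%N. Proof. by rewrite gcdn_gt0 m0. Qed.

Lemma size_root_Pmn : size f = ((m + n) %/ k).+1.
Proof.
by rewrite /root_Pmn size_binomial_product -divnDl ?dvdn_gcdl.
Qed.

Lemma block_size_gt1 : (1 < (m + n) %/ k)%N.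
Proof.
rewrite divnDl ?dvdn_gcdl // (@leq_add 1 1) // divn_gt0 // dvdn_leq //.
  exact: dvdn_gcdl.
exact: dvdn_gcdr.
Qed.

(** The color of i is the exponent of [zeta R k] in f(e i) / f(e i0). A class consists of roots of f
    minus a constant, so it has at most (m+n)/k elements; as the k classes add up to m + n, all
    bounds are equalities. *)
Lemma coloring_of_fibre (w : CC R) (e : 'I_(m + n) -> CC R) :
    w != 0 -> w != 1 -> numbering p w e ->
  exists color : 'I_(m + n) -> 'I_k,
  (forall y, #|[set i | color i == y]%SET| = ((m + n) %/ k)%N) /\
  forall s : 'S_(m + n), s \in monodromy p e <->
    exists j, forall i, color (s i) = (rotation k ^+ j)%g (color i).
Proof.
move=> w0 w1 ne; have [ei pe] := ne.
have pE i : p.[e i] = w by apply/pe; exists i.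
have fe i : f.[e i] != 0 by apply: root_Pmn_neq0; rewrite ?pE.
pose i0 := Ordinal d0.
have zk := zeta_prim R k0.
have fk i : (f.[e i] / f.[e i0]) ^+ k = 1.
  rewrite expr_div_n -!horner_exp root_PmnX // !(hornerZ _ p) !pE divff //.
  by rewrite mulf_neq0 // invr_eq0 scale_factorC_neq0.
have hc i : {y : 'I_k | f.[e i] / f.[e i0] = zeta R k ^+ y} := prim_rootP zk (fk i).
pose color i := sval (hc i).
have cE i : f.[e i] = zeta R k ^+ color i * f.[e i0].
  by rewrite /color -(svalP (hc i)) divfK.
have dk : (m + n)%N = ((m + n) %/ k * k)%N.
  by rewrite divnK // dvdn_add ?dvdn_gcdl ?dvdn_gcdr.
have le_class y : (#|[set i | color i == y]%SET| <= (m + n) %/ k)%N.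
  pose q := f - (zeta R k ^+ y * f.[e i0])%:P.
  have sq : size q = ((m + n) %/ k).+1.
    apply: size_subC; first exact: size_root_Pmn.
    exact: ltnW block_size_gt1.
  rewrite -ltnS -sq cardE -(size_map e); apply: max_poly_roots.
  - by rewrite -size_poly_eq0 sq.
  - apply/allP => _ /mapP[i + ->]; rewrite mem_enum inE => /eqP iy.
    by rewrite /root hornerD hornerN hornerC (cE i) iy subrr.
  - by rewrite (map_inj_uniq ei) enum_uniq.
exists color; split.
  move=> y; apply/eqP; rewrite eqn_leq le_class /=.
  have := card_ord (m + n); rewrite -sum1_card (partition_big color xpredT) //=.
  rewrite (bigD1 y) //= {1}sum1dep_card => tot.
  have rest : (\sum_(z < k | z != y) \sum_(i < m + n | color i == z) 1 <=
      \sum_(z < k | z != y) (m + n) %/ k)%N.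
    by apply: leq_sum => z _; rewrite sum1dep_card.
  rewrite sum_nat_const cardC1 card_ord in rest.
  rewrite -(leq_add2r (k.-1 * ((m + n) %/ k))) -mulSn prednK // mulnC -dk -{1}tot.
  by rewrite leq_add2l.
move=> s; apply: (iff_trans (monodromyE m0 n0 w0 w1 ne s)); split=> [hs|[j hj] i i'].
  (* The reference point i0 carries the ratio 1, so the color of its image is the amount of the
     rotation. *)
  exists (color (s i0)) => i; apply: val_inj.
  rewrite /= rotationX; have := hs i i0; rewrite (cE (s i)) (cE (s i0)) (cE i).
  rewrite -[LHS]mulrA [RHS]mulrACA.
  have ff : f.[e i0] * f.[e i0] != 0 by rewrite mulf_neq0.
  move=> /(mulIf ff); rewrite -exprD => /eqP.
  rewrite (eq_prim_root_expr zk) => /eqP h.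
  by rewrite (addnC (color i)) -h modn_small.
have zj u : zeta R k ^+ color (s u) = zeta R k ^+ (color u + j).
  by apply/eqP; rewrite (eq_prim_root_expr zk) hj rotationX modn_mod.
rewrite (cE (s i)) (cE (s i')) (cE i) (cE i') !zj !exprD; ring.
Qed.

End ColoringOfFibre.

Theorem theorem7p8 (R : realType) (m n : nat) (hm : (1 <= m)%N) (hn : (1 <= n)%N)
    (b : P1 R) (hb : ~ zero_one_infty b) :
  let k := gcdn m n in
  let d' := ((m + n) %/ k)%N in
  let P := poly_P1 (Pmn R m n) in
  (exists e : 'I_(m + n) -> P1 R, fibre_numbering P b e) /\
  (forall e : 'I_(m + n) -> P1 R, fibre_numbering P b e ->
    let G := Mon R P (@zero_one_infty R) b e in
    [/\ perm_isomorphic G (wreath_cyclic d' k),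
        exists Q : {set {set 'I_(m + n)}},
          [/\ block_system G Q, #|Q| = k &
              forall A : {set 'I_(m + n)}, A \in Q -> #|A| = d'],
        G = [set: 'S_(m + n)]%SET <-> gcdn m n = 1%N &
        #|G| = (d'`! ^ k * k)%N]).
Proof.
move=> k d' P; have [w [bw w0 w1]] := avoids_P1 hb; rewrite {}bw.
split=> [|e he G]; first exact: fibre_exists.
have [_ ne] := fibre_numberingP hm hn he.
have k0 : (0 < k)%N by rewrite gcdn_gt0 hm.
have d1 : (1 < d')%N by exact: block_size_gt1.
have [color [hcol hG]] := coloring_of_fibre hm hn w0 w1 ne.
rewrite -(Mon_monodromy hm hn w0 w1 he) in hG.
have iso := colored_wreath hcol hG.
split.
- exact: iso.
- exact: colored_blocks d1 hcol hG.
- exact: colored_full k0 d1 hcol hG.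
- rewrite (perm_isomorphic_card iso) card_wreath ?(ltnW d1) //.
  by rewrite -[#|_|]/(#[rotation k]%g) order_rotation.
Qed.
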